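(* Let $(\mathcal{E},\circ)$ be a Euclidean Jordan algebra of rank $r$, let $f:\mathbb{R}^r\to[-\infty,+\infty]$ be a symmetric function, and let $F:\mathcal{E}\to[-\infty,+\infty]$, $F(x)=f(\lambda(x))$, be the spectral function induced by $f$. Let $x\in\mathcal{E}$. (a) Let $\Diamond$ be any permutation compatible subdifferential for which the transfer formula $$\Diamond F(x)=\{\,s\in\mathcal{E}\mid \exists J\in\mathcal{J}(x,s)\text{ with }\operatorname{diag}(s,J)\in\Diamond f(\lambda(x))\,\}$$ holds. Then $$\operatorname{conv}\Diamond F(x)=\{\,s\in\mathcal{E}\mid \exists J\in\mathcal{J}(x,s)\text{ with }\operatorname{diag}(s,J)\in\operatorname{conv}\Diamond f(\lambda(x))\,\}.$$ (b) In particular, if $\lambda(x)\in\operatorname{int}(\operatorname{dom} f)$ and $f$ is locally Lipschitz continuous at $\lambda(x)$, then the Clarke subdifferential $\partial_C$ satisfies $$\partial_C F(x)=\{\,s\in\mathcal{E}\mid \exists J\in\mathcal{J}(x,s)\text{ with }\operatorname{diag}(s,J)\in\partial_C f(\lambda(x))\,\}.$$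
   Context: Euclidean Jordan algebras. A Euclidean Jordan algebra $(\mathcal{E},\circ)$ is a finite-dimensional real vector space with a bilinear product $\circ$ and an inner product $\langle\cdot,\cdot\rangle$ such that $x\circ y=y\circ x$, $x\circ(x^2\circ y)=x^2\circ(x\circ y)$ (with $x^2=x\circ x$), and $\langle x\circ y,z\rangle=\langle x,y\circ z\rangle$; it has an identity element $e$. An idempotent is $c$ with $c\circ c=c$; a nonzero idempotent is primitive if it is not a sum of two nonzero idempotents $\hat c,\tilde c$ with $\hat c\circ\tilde c=0$. A Jordan frame is an ordered tuple $J=[c_1,\dots,c_r]$ of primitive idempotents with $c_i\circ c_j=0$ for $i\ne j$ and $c_1+\dots+c_r=e$; all Jordan frames have the same length $r$, the rank of $\mathcal{E}$. By the spectral theorem every $x$ is $\sum_i\alpha_ic_i$ for some Jordan frame (one then says $J$ diagonalizes $x$), with the real numbers $\alpha_i$ (the eigenvalues of $x$) unique up to order. $\lambda(x)=(\lambda_1(x),\dots,\lambda_r(x))$ is the vector of eigenvalues in nonincreasing order. $\operatorname{tr}(x)=\sum_i\lambda_i(x)$. The inner product is taken to be $\langle x,y\rangle=\operatorname{tr}(x\circ y)$, with norm $\|x\|=\sqrt{\operatorname{tr}(x^2)}$. $\mathbb{R}^r$ has the usual Euclidean inner product and norm. For a Jordan frame $J=[c_1,\dots,c_r]$, $\operatorname{diag}(z,J)=(\langle c_1,z\rangle,\dots,\langle c_r,z\rangle)\in\mathbb{R}^r$. $\mathcal{J}(x,s)$ is the set of Jordan frames $J$ that diagonalize both $x$ and $s$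 and satisfy $\operatorname{diag}(x,J)=\lambda(x)$ (empty if there is none). $f$ is symmetric if $f(Pu)=f(u)$ for all $u\in\mathbb{R}^r$ and all $r\times r$ permutation matrices $P$. $\operatorname{dom} f=\{u\mid f(u)\in\mathbb{R}\}$. Here a ''subdifferential'' $\Diamond$ is any rule assigning to each function $g:V\to[-\infty,+\infty]$ ($V=\mathbb{R}^r$ or $V=\mathcal{E}$) and each point $u\in V$ a subset $\Diamond g(u)\subseteq V$. It is permutation compatible if $\Diamond g(Pu)=P\,\Diamond g(u)$ for every symmetric $g:\mathbb{R}^r\to[-\infty,+\infty]$, every $u\in\mathbb{R}^r$ and every $r\times r$ permutation matrix $P$. $f$ is locally Lipschitz continuous at $\hat u$ if there are a neighbourhood $U$ of $\hat u$ and a constant $\kappa$ with $|f(v)-f(u)|\le\kappa\|v-u\|$ for all $u,v\in U\cap\operatorname{dom} f$. Clarke subdifferential. For a subset $C$ of a finite-dimensional Euclidean space and $p\in C$, the regular normal cone is $\hat N_C(p)=\{v\mid \langle v,q-p\rangle\le o(\|q-p\|)\text{ for } q\in C\}$; the (limiting) normal cone $N_C(p)$ is the set of limits of sequences $v^k\in\hat N_C(p^k)$ with $p^k\in C$, $p^k\to p$; the convexified normal cone is $\overline N_C(p)=\operatorname{cl}\operatorname{conv}N_C(p)$. For $g:V\to[-\infty,+\infty]$ finite at $u$, $\partial_C g(u)=\{d\in V\mid (d,-1)\in\overline N_{\operatorname{epi} g}(u,g(u))\}$, where $\operatorname{epi} g=\{(v,t)\in V\times\mathbb{R}\mid g(v)\le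 t\}$. *)

(* Defs.v *)
From HB Require Import structures.
From mathcomp Require Import all_boot all_order all_algebra.
From mathcomp Require Import all_classical all_reals all_analysis.

Set Implicit Arguments.
Unset Strict Implicit.
Unset Printing Implicit Defensive.

Import Order.TTheory GRing.Theory Num.Theory.
Import numFieldNormedType.Exports.

Local Open Scope classical_set_scope.
Local Open Scope ring_scope.

(* The field [jip] is only the inner product required to exist by the
   definition of a Euclidean Jordan algebra.  All metric notions on [E] used
   below refer to the trace inner product [trip], not to [jip]. *)
Record euclidean_jordan_algebra (R : realType) (E : vectType R) := EJA {
  jmul : {bilinear E -> E -> E};
  jip : {biscalar E};
  junit : E;
  jmulC : forall x y, jmul x y = jmul y x;
  jmul_jordan : forall x y,
    jmul x (jmul (jmul x x) y) = jmul (jmul x x) (jmul x y);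
  jmul1 : forall x, jmul junit x = x;
  jipC : forall x y, jip x y = jip y x;
  jip_gt0 : forall x, x != 0 -> 0 < jip x x;
  jip_assoc : forall x y z, jip (jmul x y) z = jip x (jmul y z)
}.

Section Jordan.
Context {R : realType} {E : vectType R} (A : euclidean_jordan_algebra E).

Definition jidempotent (c : E) := jmul A c c = c.

Definition jprimitive (c : E) :=
  [/\ jidempotent c, c != 0 &
      ~ exists c1 c2 : E,
          [/\ jidempotent c1, jidempotent c2, c1 != 0 & c2 != 0] /\
          (jmul A c1 c2 = 0 /\ c = c1 + c2)].

Definition jordan_frame {r : nat} (J : 'I_r -> E) :=
  [/\ forall i, jprimitive (J i),
      forall i j, i != j -> jmul A (J i) (J j) = 0 &
      \sum_i J i = junit A].

(* All Jordan frames have the same length, so one frame of length [r]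
   determines the rank. *)
Definition has_rank (r : nat) := exists J : 'I_r -> E, jordan_frame J.

Definition diagonalizes {r : nat} (J : 'I_r -> E) (x : E) :=
  exists a : 'I_r -> R, x = \sum_i a i *: J i.

(* [eigvals r x] is meaningful when [r] is the rank: the spectral theorem then
   says that exactly one vector satisfies the defining property. *)
Definition eigvals (r : nat) (x : E) : 'cV[R]_r :=
  xget 0 [set a : 'cV[R]_r |
    (forall i j : 'I_r, (i <= j)%N -> a j 0 <= a i 0) /\
    exists2 J : 'I_r -> E, jordan_frame J & x = \sum_i a i 0 *: J i].

Definition jtr (r : nat) (x : E) : R := \sum_i eigvals r x i 0.

Definition trip (r : nat) (x y : E) : R := jtr r (jmul A x y).

Definition jdiag {r : nat} (z : E) (J : 'I_r -> E) : 'cV[R]_r :=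
  \col_i trip r (J i) z.

Definition joint_frames {r : nat} (x s : E) : set ('I_r -> E) :=
  [set J | [/\ jordan_frame J, diagonalizes J x, diagonalizes J s &
               jdiag x J = eigvals r x]].

Definition spectral_fun {r : nat} (f : 'cV[R]_r -> \bar R) : E -> \bar R :=
  fun x => f (eigvals r x).

End Jordan.

Definition edom {V : Type} {R : realType} (f : V -> \bar R) : set V :=
  [set u | f u \is a fin_num].

Definition symmetric_fun {R : realType} {r : nat} (f : 'cV[R]_r -> \bar R) :=
  forall (P : 'M[R]_r) (u : 'cV[R]_r), is_perm_mx P -> f (P *m u) = f u.

Definition subdiff (R : realType) (V : Type) := (V -> \bar R) -> V -> set V.

Definition permutation_compatible {R : realType} {r : nat}
    (D : subdiff R 'cV[R]_r) :=
  forall g : 'cV[R]_r -> \bar R, symmetric_fun g ->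
  forall (u : 'cV[R]_r) (P : 'M[R]_r), is_perm_mx P ->
    D g (P *m u) = [set P *m v | v in D g u].

Definition conv_hull {R : realType} {V : lmodType R} (B : set V) : set V :=
  smallest (@convex_set R V) B.

(* An inner product on [V] is passed as a plain function [ip], because the
   abstract space [E] carries no topology in the library; limits and closures
   are taken in the norm of [ip]. *)
Section Euclidean.
Context {R : realType} {V : lmodType R} (ip : V -> V -> R).

Definition ipnorm (v : V) : R := Num.sqrt (ip v v).

Definition ip_cvg (u : nat -> V) (l : V) :=
  (fun k => ipnorm (u k - l)) @ \oo --> (0 : R).

Definition ip_closure (C : set V) : set V :=
  [set v | forall eps : R, 0 < eps -> exists2 w, C w & ipnorm (w - v) < eps].

Definition regular_normal_cone (C : set V) (p : V) : set V :=
  [set v | forall eps : R, 0 < eps -> exists2 delta : R, 0 < delta &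
    forall q, C q -> ipnorm (q - p) < delta ->
      ip v (q - p) <= eps * ipnorm (q - p)].

Definition normal_cone (C : set V) (p : V) : set V :=
  [set v | exists pk vk : nat -> V,
    [/\ forall k, C (pk k) /\ regular_normal_cone C (pk k) (vk k),
        ip_cvg pk p & ip_cvg vk v]].

Definition convexified_normal_cone (C : set V) (p : V) : set V :=
  ip_closure (conv_hull (normal_cone C p)).

Definition ip_graph (p q : V * R^o) : R := ip p.1 q.1 + p.2 * q.2.

End Euclidean.

Definition epi {R : realType} {V : lmodType R} (g : V -> \bar R) :
    set (V * R^o)%type :=
  [set p | (g p.1 <= p.2%:E)%E].

(* Empty, by convention, where [g] is not finite. *)
Definition clarke {R : realType} {V : lmodType R} (ip : V -> V -> R) :
    subdiff R V :=
  fun g u => [set d | g u \is a fin_num /\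
    convexified_normal_cone (ip_graph ip) (epi g) (u, fine (g u)) (d, -1)].

Definition dotv {R : realType} {r : nat} (u v : 'cV[R]_r) : R :=
  \sum_i u i 0 * v i 0.

Definition locally_lipschitz_at {R : realType} {r : nat}
    (f : 'cV[R]_r -> \bar R) (u0 : 'cV[R]_r) :=
  exists2 U : set 'cV[R]_r, nbhs u0 U & exists kappa : R,
    forall u v, (U `&` edom f) u -> (U `&` edom f) v ->
      `|fine (f v) - fine (f u)| <= kappa * ipnorm dotv (v - u).

(* Main.v *)
(** Write [tr(x, y)] for the trace inner product.  For Jordan frames [J], [J']
    the Gram matrix [tr(J_i, J'_j)] is doubly stochastic, so Birkhoff's theorem
    turns statements about two frames into statements about permutations.  If
    [J] and [J'] both diagonalize [x], the Gram matrix only couples equal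
    eigenvalues of [x]; hence [diag(s, J')] is a convex combination of
    permutations of [diag(s, J)] that fix [lambda(x)].  Since the elements that
    commute with [x] form a linear space and each of them has a joint frame
    with [x], a set of the form [{s | diag(s, J) in K}] with [K] convex and
    invariant under these permutations is convex, and it is closed if [K] is.
    This is (a).

    For (b), the same argument is applied to the normal cone of the epigraph,
    once limiting normals to [epi F] at [(x, t)] are known to be the lifts of
    limiting normals to [epi f] at [(lambda(x), t)].  A regular normal at
    [(p, t)] is orthogonal to the curves obtained from [p] by rotating a frame,
    so it commutes with [p].  Conversely the trace inequality
    [tr(x, y) <= lambda(x) . lambda(y)], together with the identity
    [2 (lambda(x) . lambda(y) - tr(x, y)) = |x - y|^2 - |lambda(x) - lambda(y)|^2],
    bounds the error made by lifting a regular normal by [O(|y - p|^2)]. *)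
Require Import Defs.
From HB Require Import structures.
From mathcomp Require Import all_boot all_order all_algebra all_fingroup.
From mathcomp Require Import all_classical all_reals all_analysis.
From mathcomp Require Import ring lra complex.

Set Implicit Arguments.
Unset Strict Implicit.
Unset Printing Implicit Defensive.

Import Order.TTheory GRing.Theory Num.Theory.
Import numFieldNormedType.Exports.

Local Open Scope classical_set_scope.
Local Open Scope ring_scope.

(** * Birkhoff's theorem *)

(** Two obstacles shape the development. The trace is defined through eigenvalues, so its
    bilinearity and associativity are not visible. They come from a vector [q] with [jip A q d = 1]
    for every primitive [d]. The given form may be scaled differently on different simple ideals, so
    the members of a frame are weighted by their inverse squared lengths; these weights are
    consistent because non-orthogonal primitive idempotents have equal length. Secondly, the
    existence of a joint frame is not visibly linear or closed in [s]. It is replaced by [opcomm],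
    the commutation of the two multiplication operators, which is bilinear and equivalent to it;
    closedness becomes an estimate. No limit of frames is ever taken: Birkhoff's theorem supplies
    matchings between coordinates taken in different frames. *)

Section Hall.
Variables (T : finType) (e : rel T).

Definition neighbours (Y S : {set T}) : {set T} :=
  [set y in Y | [exists x in S, e x y]].

(** Halmos-Vaughan induction on [#|X|]: a tight proper subset and its complement are matched
    separately; if no proper nonempty subset is tight, there is enough slack to remove one matched
    pair. *)
Lemma hall (X Y : {set T}) :
  (forall S : {set T}, S \subset X -> #|S| <= #|neighbours Y S|)%N ->
  exists f : T -> T, {in X &, injective f} /\
    forall x, x \in X -> f x \in Y /\ e x (f x).
Proof.
have [n] := ubnP #|X|; elim: n X Y => // n IHn X Y; rewrite ltnS => leXn HX.
have [-> | [x0 x0X]] := set_0Vmem X.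
  by exists id; split => x; rewrite inE.
have [/existsP[S /and4P[sSX S0 neSX /eqP tS]] | noS] := boolP
  [exists S : {set T}, [&& S \subset X, S != finset.set0, S != X &
                           #|S| == #|neighbours Y S|]].
- have pSX : S \proper X by rewrite finset.properEneq neSX.
  have [||f1 [f1i f1P]] := IHn S Y _ _.
  + by apply: leq_trans leXn; apply: proper_card.
  + by move=> S' sS'; apply: HX; apply: fintype.subset_trans sSX.
  have [||f2 [f2i f2P]] := IHn (X :\: S) (Y :\: neighbours Y S) _ _.
  + apply: leq_trans leXn; apply: proper_card; rewrite properE finset.subsetDl /=.
    apply/negP => /fintype.subsetP H; case/finset.set0Pn: S0 => z zS.
    by have := H z (fintype.subsetP sSX z zS); rewrite !inE zS.
  + move=> S' sS'.
    have S'S : S :&: S' = finset.set0.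
      apply/finset.setP => z; rewrite !inE; apply/negP => /andP[zS zS'].
      by have := fintype.subsetP sS' z zS'; rewrite !inE zS.
    have sSS' : S :|: S' \subset X.
      by rewrite finset.subUset sSX (fintype.subset_trans sS') ?finset.subsetDl.
    have := HX _ sSS'; rewrite cardsU S'S cards0 subn0 tS.
    have -> : neighbours Y (S :|: S') =
              neighbours Y S :|: neighbours (Y :\: neighbours Y S) S'.
      apply/finset.setP => y; rewrite !inE; apply/idP/idP.
      * case/andP => yY /existsP[z /andP[]]; rewrite inE yY /=.
        case/orP => zS zy; first by rewrite (introT existsP) //; exists z; rewrite zS.
        case: (boolP [exists x in S, e x y]) => //= _.
        by apply/existsP; exists z; rewrite zS.
      * case/orP => /andP[yY /existsP[z /andP[zS zy]]].
          by rewrite yY; apply/existsP; exists z; rewrite inE zS.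
        case/andP: yY => _ ->; apply/existsP; exists z.
        by rewrite inE zS orbT.
    rewrite cardsU.
    suff -> : neighbours Y S :&: neighbours (Y :\: neighbours Y S) S' = finset.set0.
      by rewrite cards0 subn0 leq_add2l.
    apply/finset.setP => y; rewrite !inE.
    by case: (y \in Y) => //=; case: (boolP [exists x in S, e x y]).
  exists (fun x => if x \in S then f1 x else f2 x); split.
  + move=> x y xX yX; case: ifP => xS; case: ifP => yS; first exact: f1i.
    * have [|] := f2P y; first by rewrite !inE yS.
      rewrite !inE => /andP[+ yY] _ exy; case/negP; rewrite yY /=.
      by apply/existsP; exists x; rewrite xS -exy; case: (f1P x xS).
    * have [|] := f2P x; first by rewrite !inE xS.
      rewrite !inE => /andP[+ xY] _ exy; case/negP; rewrite xY /=.
      by apply/existsP; exists y; rewrite yS exy; case: (f1P y yS).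
    * by apply: f2i; rewrite !inE ?xS ?yS.
  + move=> x xX; case: ifP => xS; first exact: f1P.
    by have [|] := f2P x; rewrite ?inE ?xS //= => /andP[].
- have big (S : {set T}) : S \subset X -> S != finset.set0 -> S != X ->
    (#|S| < #|neighbours Y S|)%N.
    move=> sSX S0 neSX; rewrite ltn_neqAle HX // andbT.
    by apply: contra noS => tS; apply/existsP; exists S; apply/and4P.
  have [y0] : exists y, y \in neighbours Y [set x0]%SET.
    apply/card_gt0P; apply: leq_trans (HX _ _); first by rewrite cards1.
    by rewrite finset.sub1set.
  rewrite inE => /andP[y0Y /existsP[x1]]; rewrite inE => /andP[/eqP-> exy0].
  have [||f [fi fP]] := IHn (X :\ x0) (Y :\ y0) _ _.
  + by apply: leq_trans leXn; rewrite (cardsD1 x0 X) x0X.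
  + move=> S sS; have [-> | S0] := eqVneq S finset.set0; first by rewrite cards0.
    have sSX : S \subset X by apply: fintype.subset_trans sS (finset.subsetDl _ _).
    have neSX : S != X.
      by apply: contraTneq sS => ->; apply/negP => /fintype.subsetP/(_ _ x0X);
        rewrite !inE eqxx.
    have := big S sSX S0 neSX; rewrite (cardsD1 y0 (neighbours Y S)) => H.
    have -> : neighbours (Y :\ y0) S = neighbours Y S :\ y0.
      by apply/finset.setP => y; rewrite !inE andbA.
    by move: H; case: (y0 \in _); rewrite ?add1n ?add0n ?ltnS // => /ltnW.
  exists (fun x => if x == x0 then y0 else f x); split.
  + move=> x y xX yX; case: eqP => [-> | /eqP nx]; case: eqP => [-> | /eqP ny] //.
    * have [|] := fP y; first by rewrite !inE ny.
      by rewrite !inE => /andP[/eqP ne _] _ /esym.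
    * have [|] := fP x; first by rewrite !inE nx.
      by rewrite !inE => /andP[/eqP ne _] _.
    * by apply: fi; rewrite !inE ?nx ?ny.
  + move=> x xX; case: eqP => [-> // | /eqP nx].
    by have [|] := fP x; rewrite ?inE ?nx //= => /andP[].
Qed.

End Hall.

Section Birkhoff.
Variables (R : realFieldType) (n : nat).
Implicit Types (D : 'M[R]_n) (s : {perm 'I_n}).

Definition doubly_stochastic D :=
  [/\ forall i j, 0 <= D i j, forall i, \sum_j D i j = 1 &
      forall j, \sum_i D i j = 1].

(** Double counting: the rows in [S] have total mass [#|S|], all of it in the neighbouring columns,
    and each column holds at most 1, so [hall] applies. *)
Lemma doubly_stochastic_support_perm D :
  doubly_stochastic D -> exists s : {perm 'I_n}, forall i, 0 < D i (s i).
Proof.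
move=> [D0 Dr Dc].
pose e : rel 'I_n := fun i j => 0 < D i j.
have [|f [fi fP]] := @hall _ e finset.setT finset.setT.
  move=> S _; rewrite -(ler_nat R).
  have -> : #|S|%:R = \sum_(i in S) \sum_j D i j :> R.
    by under eq_bigr do rewrite Dr; rewrite sumr_const.
  rewrite exchange_big /= (bigID (mem (neighbours e finset.setT S))) /=.
  rewrite [X in _ + X]big1 ?addr0; last first.
    move=> j; rewrite !inE /= => /existsPn H; apply: big1 => i iS.
    by apply/eqP; rewrite eq_le D0 leNgt andbT; have := H i; rewrite iS.
  rewrite -sum1_card natr_sum; apply: ler_sum => j _.
  by rewrite -(Dc j) [leRHS](bigID (mem S)) /= lerDl sumr_ge0.
have fI : injective f by move=> i j; apply: fi; rewrite inE.
by exists (perm fI) => i; rewrite permE; case: (fP i _) => //; rewrite inE.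
Qed.

(** An induction principle over the permutations in the support of [D]: remembering that support is
    what later confines them to equal eigenvalues. The induction is on the number of nonzero
    entries. *)
Lemma birkhoff D (K : 'M[R]_n -> Prop) :
  (forall M N t, K M -> K N -> 0 <= t -> t <= 1 -> K (t *: M + (1 - t) *: N)) ->
  doubly_stochastic D ->
  (forall s, (forall i, 0 < D i (s i)) -> K (perm_mx s)) -> K D.
Proof.
move=> Kc.
have [m] := ubnP #|[set p : 'I_n * 'I_n | D p.1 p.2 != 0]%SET|.
elim: m D => // m IHm D; rewrite ltnS => leDm DD KD.
have [s sP] := doubly_stochastic_support_perm DD.
case: (DD) => D0 Dr Dc.
have [-> | neD] := eqVneq D (perm_mx s); first exact: KD.
have [k /eqP Dk] : exists k, D k (s k) != 1.
  apply/existsP; apply: contraNT neD => /existsPn H; apply/eqP/matrixP => i j.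
  have Dis : D i (s i) = 1 by have := H i; rewrite negbK => /eqP.
  rewrite !mxE; have [<- // | nj] := eqVneq (s i) j.
  have := Dr i; rewrite (bigD1 (s i)) //= Dis => /eqP.
  rewrite -subr_eq0 addrAC subrr add0r => /eqP/psumr_eq0P -> //.
  by rewrite eq_sym.
(* Subtracting the least entry along [s] keeps the matrix nonnegative and kills an entry. The entry
   at [k] differs from 1, so [t < 1] and the rest can be rescaled. *)
have [i0 _ i0min] := arg_minP (fun i => D i (s i)) (erefl true : predT k).
set t := D i0 (s i0) in i0min.
have t_gt0 : 0 < t by apply: sP.
have Dle1 i j : D i j <= 1.
  by rewrite -(Dr i) (bigD1 j) //= lerDl sumr_ge0.
have t_lt1 : t < 1.
  by apply: le_lt_trans (i0min k _) _ => //; rewrite lt_neqAle Dle1 andbT; apply/eqP.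
have u_gt0 : 0 < 1 - t by rewrite subr_gt0.
pose D' := (1 - t)^-1 *: (D - t *: perm_mx s).
have -> : D = t *: perm_mx s + (1 - t) *: D'.
  by rewrite /D' scalerA divff ?gt_eqF // scale1r addrC subrK.
have D'E i j : D' i j = (1 - t)^-1 * (D i j - t * (s i == j)%:R) by rewrite !mxE.
have D'0 i j : D i j = 0 -> D' i j = 0.
  move=> Dij; rewrite D'E Dij; case: eqP => [sij | _]; last by rewrite mulr0 subrr mulr0.
  by have := sP i; rewrite sij Dij ltxx.
apply: Kc (ltW t_gt0) (ltW t_lt1); first exact: KD.
apply: IHm.
- apply: leq_trans leDm; apply: proper_card; apply/properP; split.
    by apply/fintype.subsetP => -[i j]; rewrite !inE /=; apply: contra => /eqP/D'0->.
  exists (i0, s i0); rewrite !inE /=; first by rewrite gt_eqF.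
  by rewrite negbK D'E eqxx mulr1 subrr mulr0.
- split => [i j | i | j].
  + rewrite D'E mulr_ge0 ?invr_ge0 ?(ltW u_gt0) // subr_ge0.
    by case: eqP => [<- | _]; rewrite ?mulr1 ?mulr0 //; apply: i0min.
  + under eq_bigr do rewrite D'E.
    rewrite -mulr_sumr big_split /= sumrN -mulr_sumr Dr (bigD1 (s i)) //= eqxx.
    by rewrite big1 ?addr0 ?mulr1 ?mulVf ?gt_eqF // => j; rewrite eq_sym => /negPf->.
  + under eq_bigr do rewrite D'E.
    rewrite -mulr_sumr big_split /= sumrN -mulr_sumr Dc.
    rewrite (bigD1 ((s^-1)%g j)) //= permKV eqxx.
    rewrite big1 ?addr0 ?mulr1 ?mulVf ?gt_eqF // => i ni.
    by case: eqP => // sij; rewrite -sij permK eqxx in ni.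
- move=> s' s'P; apply: KD => i.
  have := s'P i; apply: contraTT; rewrite -!leNgt => Dis.
  by rewrite D'0 //; apply/eqP; rewrite eq_le Dis D0.
Qed.

(** If every permutation in the support cost more than [D], the open half-space of matrices of
    larger cost would contain them all, hence [D] itself. *)
Lemma birkhoff_min D (C : 'M[R]_n) : doubly_stochastic D ->
  exists2 s : {perm 'I_n}, forall i, 0 < D i (s i) &
    \sum_i C i (s i) <= \sum_i \sum_j D i j * C i j.
Proof.
move=> DD; apply: contrapT => H.
pose S := \sum_i \sum_j D i j * C i j.
suff: S < \sum_i \sum_j D i j * C i j by rewrite ltxx.
apply: (@birkhoff D (fun M => S < \sum_i \sum_j M i j * C i j)) => //.
- move=> M N t SM SN t0 t1.
  have -> : \sum_i \sum_j (t *: M + (1 - t) *: N) i j * C i j =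
     t * (\sum_i \sum_j M i j * C i j) + (1 - t) * (\sum_i \sum_j N i j * C i j).
    rewrite !mulr_sumr -big_split; apply: eq_bigr => i _ /=.
    rewrite !mulr_sumr -big_split; apply: eq_bigr => j _ /=.
    by rewrite !mxE; ring.
  move: (\sum_i _) (\sum_i _) SM SN => y x Sx Sy.
  have [z [zx zy Sz]] : exists z : R, [/\ z <= x, z <= y & S < z].
    by exists (Num.min x y); rewrite lt_min Sx Sy ge_min lexx ge_min lexx orbT.
  have H1 : t * z <= t * x by rewrite ler_wpM2l.
  have H2 : (1 - t) * z <= (1 - t) * y by rewrite ler_wpM2l // subr_ge0.
  apply: lt_le_trans Sz _; have -> : z = t * z + (1 - t) * z by ring.
  exact: lerD.
- move=> s sP; rewrite ltNge; apply/negP => Hs; apply: H; exists s => //.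
  apply: le_trans Hs; apply: ler_sum => i _.
  rewrite (bigD1 (s i)) //= !mxE eqxx mul1r big1 ?addr0 // => j.
  by rewrite !mxE eq_sym => /negPf->; rewrite mul0r.
Qed.

End Birkhoff.

(** * Eigenvector decomposition for a selfadjoint operator *)

Section Selfadjoint.
Local Open Scope complex_scope.
Variables (R : realType) (E : vectType R) (T : {linear E -> E}).
Variable form : {biscalar E}.
Hypothesis form_gt0 : forall x, x != 0 -> 0 < form x x.
Hypothesis T_selfadjoint : forall x y, form (T x) y = form x (T y).

Implicit Types (p q : {poly R}) (x : E).

(** The vector [p(T) x]. Eigencomponents are kept as polynomials in [T] so that they later inherit
    commutation from the powers of an element. *)
Definition polyact (p : {poly R}) (x : E) : E :=
  \sum_(i < size p) p`_i *: iter i T x.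

Lemma polyact_wide n p x : (size p <= n)%N ->
  polyact p x = \sum_(i < n) p`_i *: iter i T x.
Proof.
move=> le; rewrite /polyact (big_ord_widen n (fun i => p`_i *: iter i T x)) //.
rewrite big_mkcond /=; apply: eq_bigr => i _.
by case: ltnP => // h; rewrite nth_default // scale0r.
Qed.

Lemma polyactD p q x : polyact (p + q) x = polyact p x + polyact q x.
Proof.
pose n := maxn (size p) (size q).
rewrite !(@polyact_wide n) ?leq_maxl ?leq_maxr ?size_polyD // -big_split /=.
by apply: eq_bigr => i _; rewrite coefD scalerDl.
Qed.

Lemma polyactC c x : polyact c%:P x = c *: x.
Proof.
by rewrite (@polyact_wide 1) ?size_polyC ?leq_b1 // big_ord1 coefC.
Qed.

Lemma polyactMX p x : polyact (p * 'X) x = T (polyact p x).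
Proof.
have le : (size (p * 'X)%R <= (size p).+1)%N.
  by apply: leq_trans (size_polyMleq _ _) _; rewrite size_polyX addn2.
rewrite (polyact_wide _ le) big_ord_recl coefMX /= scale0r add0r linear_sum.
by apply: eq_bigr => i _; rewrite coefMX /= linearZ.
Qed.

Lemma polyact_is_linear p : linear (polyact p).
Proof.
elim/poly_ind: p => [|p c IHp] a x y.
  by rewrite /polyact size_poly0 !big_ord0 scaler0 addr0.
rewrite !polyactD !polyactC !polyactMX IHp linearP.
by rewrite !scalerDr !scalerA (mulrC c) addrACA.
Qed.

Lemma polyactM p q x : polyact (p * q) x = polyact p (polyact q x).
Proof.
elim/poly_ind: p => [|p c IHp].
  by rewrite mul0r /polyact size_poly0 !big_ord0.
rewrite mulrDl !polyactD -mulrA ['X * q]mulrC mulrA !polyactMX IHp polyactC.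
congr (_ + _); rewrite -[q]coefK mul_polyC.
rewrite /polyact coefK scaler_sumr.
have le : (size (c *: q) <= size q)%N by apply: size_scale_leq.
rewrite -/(polyact (c *: q) x) (polyact_wide _ le).
by apply: eq_bigr => i _; rewrite coefZ scalerA.
Qed.

Lemma polyactXsubC a x : polyact ('X - a%:P) x = T x - a *: x.
Proof.
rewrite -polyCN polyactD polyactC scaleNr -[X in polyact X]mul1r polyactMX.
by rewrite -polyC1 polyactC scale1r.
Qed.

Lemma polyact0 p : polyact p 0 = 0.
Proof.
by have := polyact_is_linear p (-1) 0 0; rewrite scaler0 addr0 scaleN1r addNr.
Qed.

Lemma polyact_annihilator x : exists2 p : {poly R}, p != 0 & polyact p x = 0.
Proof.
pose X := [tuple iter i T x | i < (\dim (fullv : {vspace E})).+1].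
have : ~~ free X.
  apply/negP => /eqP fX; have := dimvS (subvf <<X>>%VS).
  by rewrite fX size_tuple ltnn.
move=> nfX; apply: contrapT => H; case/negP: nfX; apply/freeP => k Xk i.
apply: contrapT => ki; apply: H.
exists (\poly_(j < (\dim (fullv : {vspace E})).+1) k (inord j)).
  apply/eqP => /(congr1 (fun p : {poly R} => p`_i)).
  by rewrite coef_poly ltn_ord coef0 inord_val.
rewrite (polyact_wide _ (size_poly _ _)) -[RHS]Xk; apply: eq_bigr => j _.
by rewrite coef_poly ltn_ord inord_val -tnth_nth tnth_mktuple.
Qed.

Lemma form_eq0 x : form x x = 0 -> x = 0.
Proof.
move=> h; apply: contrapT => /eqP/form_gt0; by rewrite h ltxx.
Qed.

Lemma form_ge0 x : 0 <= form x x.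
Proof.
have [-> | /form_gt0/ltW //] := eqVneq x 0; by rewrite linear0r.
Qed.

Lemma XsubC_selfadjoint a x y :
  form (T x - a *: x) y = form x (T y - a *: y).
Proof.
by rewrite linearBl linearBr /= linearZl_LR linearZr_LR /= T_selfadjoint.
Qed.

(** Selfadjointness gives [|(T - a) x|^2 = <x, (T - a)^2 x>], so a repeated root may be made
    simple. *)
Lemma XsubC_sq a x :
  polyact ('X - a%:P) (polyact ('X - a%:P) x) = 0 -> polyact ('X - a%:P) x = 0.
Proof.
rewrite !polyactXsubC => h; apply: form_eq0.
by rewrite XsubC_selfadjoint h linear0r.
Qed.

(** Pairing with [x] gives [|(T - a) x|^2 + b^2 |x|^2 = 0]: a pair of nonreal roots contributes
    nothing. *)
Lemma quadratic_ann a b x : b != 0 ->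
  polyact (('X - a%:P) ^+ 2 + (b ^+ 2)%:P) x = 0 -> x = 0.
Proof.
move=> b0; rewrite polyactD polyactC expr2 polyactM !polyactXsubC => h.
set v := T x - a *: x in h.
have hv : form v v + b ^+ 2 * form x x = 0.
  rewrite {1}/v XsubC_selfadjoint -[b ^+ 2 * _](linearZr_LR form) /=.
  by rewrite -linearDr /= h linear0r.
apply: form_eq0; apply/eqP; have := form_ge0 x; rewrite le_eqVlt eq_sym.
case/orP => // x0; have : 0 < b ^+ 2 * form x x by rewrite mulr_gt0 // exprn_even_gt0.
by move=> /(ltr_wpDl (form_ge0 v)); rewrite hv ltxx.
Qed.

(** A complex root of the annihilator yields a real factor: linear for a real root, kept only once;
    quadratic for a nonreal one, acting injectively and therefore dropped. *)
Lemma polyact_split p x : p != 0 -> polyact p x = 0 ->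
  exists2 s : seq R, uniq s & polyact (\prod_(a <- s) ('X - a%:P)) x = 0.
Proof.
have [n] := ubnP (size p); elim: n p x => // n IHn p x; rewrite ltnS => len p0 px.
have [/size_poly1P[c c0 pc] | p1] := boolP (size p == 1%N).
  exists [::] => //; rewrite big_nil -polyC1 polyactC.
  move: px; rewrite pc polyactC => /eqP.
  by rewrite scaler_eq0 (negPf c0) => /eqP->; rewrite scaler0.
have [z] : exists z : R[i], root (map_poly (real_complex R) p) z.
  apply/closed_rootP; by rewrite size_map_poly.
case: z => a b; have [-> | b0] := eqVneq b 0.
  rewrite -[_ +i* 0]/(real_complex R a) fmorph_root => /factor_theorem[q pq].
  have q0 : q != 0 by apply: contra_neq p0 => q0; rewrite pq q0 mul0r.
  have [||s us sx] := IHn q (polyact ('X - a%:P) x) _ q0.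
  - by apply: leq_trans len; rewrite pq size_Mmonic ?monicXsubC // size_XsubC addn2.
  - by rewrite -polyactM -pq.
  have [ains | anins] := boolP (a \in s).
    exists s => //; rewrite (big_rem a) //= polyactM.
    apply: XsubC_sq; move: sx; rewrite (big_rem a) //= -!polyactM => <-.
    by congr (polyact _ x); rewrite -mulrA [_ * ('X - _)]mulrC.
  exists (a :: s); first by rewrite /= anins.
  by rewrite big_cons mulrC polyactM.
move=> pz.
pose q := ('X - a%:P) ^+ 2 + (b ^+ 2)%:P.
have sq : size q = 3%N.
  rewrite size_polyDl ?size_exp_XsubC // size_polyC.
  by case: (_ != 0).
have qz : (map_poly (real_complex R) q).[a +i* b] = 0.
  rewrite rmorphD /= rmorphXn /= map_polyXsubC map_polyC !hornerE /=.
  by apply/eqP; rewrite eq_complex /=; simpc; apply/andP; split=> //; apply/eqP; ring.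
have pq := divp_eq p q.
(* The remainder has degree at most 1 and vanishes at a nonreal point, so both of its real
   coefficients are 0. *)
have r0 : p %% q = 0.
  have sr : (size (p %% q)%R <= 2)%N by rewrite -ltnS -sq ltn_modp -size_poly_gt0 sq.
  have : (map_poly (real_complex R) (p %% q)).[a +i* b] = 0.
    move/rootP: pz; rewrite {1}pq rmorphD rmorphM /= hornerD hornerM qz.
    by rewrite mulr0 add0r.
  rewrite (@horner_coef_wide _ 2); last by rewrite size_map_poly.
  rewrite !big_ord_recl big_ord0 /= !coef_map /= => /eqP.
  rewrite eq_complex /=; simpc; rewrite /bump /= addn0 => /andP[/eqP h1 /eqP h2].
  have k1 : (p %% q)`_1 = 0.
    by apply: (mulIf b0); rewrite mul0r.
  have k0 : (p %% q)`_0 = 0.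
    by move: h1; rewrite k1 mul0r addr0.
  apply/polyP => -[|[|i]]; rewrite coef0 //.
  by apply: nth_default; apply: leq_trans sr _.
rewrite r0 addr0 in pq.
have q1 : p %/ q != 0 by apply: contra_neq p0 => h; rewrite pq h mul0r.
apply: (IHn (p %/ q)) => //.
  apply: leq_trans len; rewrite {2}pq size_mul // -?size_poly_gt0 ?sq //.
  by rewrite addn3.
by apply: (@quadratic_ann a _ _ b0); rewrite -polyactM -/q mulrC -pq.
Qed.

(** Lagrange interpolation one root at a time: [g] is 1 at [a] and divisible by the other factors,
    so [g(T) x] is an eigenvector and [(1 - g)(T) x] is annihilated by the shorter product. *)
Lemma polyact_eigen_split s x : uniq s ->
  polyact (\prod_(a <- s) ('X - a%:P)) x = 0 ->
  exists w : R -> {poly R}, x = \sum_(a <- s) polyact (w a) x /\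
    forall a, a \in s -> T (polyact (w a) x) = a *: polyact (w a) x.
Proof.
elim: s x => [|a s IHs] x /=.
  move=> _; rewrite big_nil -polyC1 polyactC scale1r => x0.
  by exists (fun=> 0); rewrite big_nil.
case/andP => anins us; rewrite big_cons; set P := \prod_(_ <- _) _ => Px.
have Pa0 : P.[a] != 0 by rewrite -[_ == 0]/(root P a) root_prod_XsubC.
pose g := P.[a]^-1 *: P.
have key : polyact P (polyact (1 - g) x) = 0.
  have /factor_theorem[h Ph] : root (1 - g) a.
    by rewrite /root /g !hornerE mulVf // subrr.
  rewrite -polyactM Ph (_ : P * _ = h * (('X - a%:P) * P)); last by ring.
  by rewrite polyactM Px polyact0.
have [w [xw Tw]] := IHs _ us key.
exists (fun b => if b == a then g else w b * (1 - g)); split.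
  rewrite big_cons eqxx.
  have -> : \sum_(j <- s) polyact (if j == a then g else w j * (1 - g)) x
     = polyact (1 - g) x.
    rewrite [RHS]xw; apply: eq_big_seq => b bs.
    by case: eqP => [ba | _]; [rewrite -ba bs in anins | rewrite polyactM].
  by rewrite -polyactD addrC subrK -polyC1 polyactC scale1r.
move=> b; rewrite inE; case: eqP => [-> _ | _ /= bs]; last by rewrite polyactM Tw.
apply/eqP; rewrite -subr_eq0 -polyactXsubC -polyactM /g.
by rewrite -scalerAr -mul_polyC polyactM Px polyact0.
Qed.

Lemma selfadjoint_eigen_split x :
  exists (s : seq R) (w : R -> {poly R}),
    [/\ uniq s, x = \sum_(a <- s) polyact (w a) x &
     forall a, a \in s -> T (polyact (w a) x) = a *: polyact (w a) x].
Proof.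
have [p p0 px] := polyact_annihilator x.
have [s us sx] := polyact_split p0 px.
by have [w [xw Tw]] := polyact_eigen_split us sx; exists s, w.
Qed.

End Selfadjoint.

(** * Peirce decomposition *)

Section Peirce.
Variables (R : realType) (E : vectType R) (A : euclidean_jordan_algebra E).
Local Notation "x ** y" := (jmul A x y) (at level 40, left associativity).
Local Notation ip := (jip A).
Implicit Types (x y z u v w c d : E) (a b : R).

Lemma jmulDl x y z : (x + y) ** z = x ** z + y ** z. Proof. exact: linearDl. Qed.
Lemma jmulDr x y z : z ** (x + y) = z ** x + z ** y. Proof. exact: linearDr. Qed.
Lemma jmulBl x y z : (x - y) ** z = x ** z - y ** z. Proof. exact: linearBl. Qed.
Lemma jmulNl x z : (- x) ** z = - (x ** z). Proof. exact: linearNl. Qed.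
Lemma jmulNr x z : z ** (- x) = - (z ** x). Proof. exact: linearNr. Qed.
Lemma jmul0l z : 0 ** z = 0. Proof. exact: linear0l. Qed.
Lemma jmul0r z : z ** 0 = 0. Proof. exact: linear0r. Qed.
Lemma jmulZl a x z : (a *: x) ** z = a *: (x ** z). Proof. exact: linearZl_LR. Qed.
Lemma jmulZr a x z : z ** (a *: x) = a *: (z ** x). Proof. exact: linearZr_LR. Qed.
Lemma jmul_suml I (r : seq I) (P : pred I) (F : I -> E) z :
  (\sum_(i <- r | P i) F i) ** z = \sum_(i <- r | P i) F i ** z.
Proof. exact: linear_sumlz. Qed.
Lemma jmul_sumr I (r : seq I) (P : pred I) (F : I -> E) z :
  z ** (\sum_(i <- r | P i) F i) = \sum_(i <- r | P i) z ** F i.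
Proof. exact: linear_sumr. Qed.

Definition jmulE :=
  (jmulDl, jmulDr, jmulNl, jmulNr, jmul0l, jmul0r, jmulZl, jmulZr).

Lemma jipDl x y z : ip (x + y) z = ip x z + ip y z. Proof. exact: linearDl. Qed.
Lemma jipDr x y z : ip z (x + y) = ip z x + ip z y. Proof. exact: linearDr. Qed.
Lemma jipNl x z : ip (- x) z = - ip x z. Proof. exact: linearNl. Qed.
Lemma jipNr x z : ip z (- x) = - ip z x. Proof. exact: linearNr. Qed.
Lemma jip0l z : ip 0 z = 0. Proof. exact: linear0l. Qed.
Lemma jip0r z : ip z 0 = 0. Proof. exact: linear0r. Qed.
Lemma jipZl a x z : ip (a *: x) z = a * ip x z. Proof. exact: linearZl_LR. Qed.
Lemma jipZr a x z : ip z (a *: x) = a * ip z x. Proof. exact: linearZr_LR. Qed.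

Definition jipE := (jipDl, jipDr, jipNl, jipNr, jip0l, jip0r, jipZl, jipZr).

Lemma jip_inj x y : (forall z, ip x z = ip y z) -> x = y.
Proof.
move=> h; apply/eqP; rewrite -subr_eq0; apply/negPn/negP => /(jip_gt0 A).
by rewrite jipDl jipNl h subrr ltxx.
Qed.

Lemma jip_eq0 x : ip x x = 0 -> x = 0.
Proof. by move=> h; apply/eqP/negPn/negP => /(jip_gt0 A); rewrite h ltxx. Qed.

Lemma jip_selfadjoint x y z : ip (x ** y) z = ip y (x ** z).
Proof. by rewrite jmulC jip_assoc. Qed.

Lemma jmul1r x : x ** junit A = x. Proof. by rewrite jmulC jmul1. Qed.

(* The part of the Jordan identity for [x + z] that is linear in [z]. *)
Lemma jordan_linearized x y z :
  (x ** x ** y) ** z =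
  x ** x ** (y ** z) + 2 *: ((x ** z) ** (x ** y)) - 2 *: (x ** ((x ** z) ** y)).
Proof.
(* The difference of these two keeps degrees 1 and 3 in [z]; the identity for [z] removes degree 3.
   Pairing with an arbitrary [w] leaves real linear arithmetic. *)
have Hp := jmul_jordan A (x + z) y; have Hm := jmul_jordan A (x - z) y.
have Hz := jmul_jordan A z y.
apply: jip_inj => w; move: Hp Hm Hz.
rewrite !jmulE !opprD !opprK !(jmulC A z x).
rewrite (jmulC A (x ** x ** y) z) (jmulC A y z).
move=> /(congr1 (ip^~ w)) + /(congr1 (ip^~ w)) + /(congr1 (ip^~ w)).
by rewrite !jipE => *; lra.
Qed.


(** Commutation of multiplication operators. Being linear in each argument, it is easier to handle
    than a common frame, to which [joint_opcomm] and [opcomm_joint] tie it. *)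
Definition opcomm x y := forall z, x ** (y ** z) = y ** (x ** z).

Lemma opcomm_sym x y : opcomm x y -> opcomm y x.
Proof. by move=> h z; rewrite h. Qed.

Lemma opcommZDl a x y z : opcomm x z -> opcomm y z -> opcomm (a *: x + y) z.
Proof. by move=> hx hy t; rewrite !jmulE hx hy. Qed.

(** The linearized Jordan identity says that [2 * a - 1] times the commutator of the two operators
    vanishes; only the half space escapes. *)
Lemma opcomm_eigen c w a : jidempotent A c -> c ** w = a *: w -> a != 2^-1 ->
  opcomm c w.
Proof.
move=> hc cw a2 y; have := jordan_linearized c y w; rewrite hc cw.
rewrite !jmulE !scalerA ![_ ** w]jmulC => h.
have a2' : 2 * a - 1 != 0.
  by apply: contra_neq a2 => h2; apply: (mulfI (_ : 2 != 0 :> R)) => //; lra.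
apply: (scalerI a2'); apply: jip_inj => t; move: h => /(congr1 (ip^~ t)).
by rewrite !jipE => h; lra.
Qed.

Section Idempotent.
Variable c : E.
Hypothesis hc : jidempotent A c.

(** Multiplication by [c] is a root of [2 t^3 - 3 t^2 + t], whose zeros are 0, 1/2 and 1. *)
Lemma idem_cubic x : c ** x = 3 *: (c ** (c ** x)) - 2 *: (c ** (c ** (c ** x))).
Proof.
have := jordan_linearized c c x; rewrite !hc ![_ ** c]jmulC => h.
by apply: jip_inj => t; move: h => /(congr1 (ip^~ t)); rewrite !jipE => h; lra.
Qed.

Lemma peirce_split x : exists x1 xh x0, [/\ c ** x1 = x1, c ** xh = 2^-1 *: xh,
  c ** x0 = 0 & x = x1 + xh + x0].
Proof.
have h := idem_cubic x.
(* Lagrange polynomials for the eigenvalues 1, 1/2 and 0: [2 t^2 - t], [4 (t - t^2)] and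
   [1 - 3 t + 2 t^2]. *)
exists (2 *: (c ** (c ** x)) - c ** x), (4 *: (c ** x - c ** (c ** x))).
exists (x - 3 *: (c ** x) + 2 *: (c ** (c ** x))).
by split; apply: jip_inj => t; move: h => /(congr1 (ip^~ t)); rewrite ?jmulE ?jipE; lra.
Qed.

Lemma peirce1_opcomm x : c ** x = x -> opcomm c x.
Proof.
move=> cx; apply: (@opcomm_eigen c x 1) => //; first by rewrite scale1r.
by rewrite eq_sym invr_eq1 pnatr_eq1.
Qed.

Lemma peirce0_opcomm x : c ** x = 0 -> opcomm c x.
Proof.
move=> cx; apply: (@opcomm_eigen c x 0) => //; first by rewrite scale0r.
by rewrite eq_sym invr_eq0 pnatr_eq0.
Qed.

(** [c ** (x ** y)] is [x ** y] by commutation with [y], and 0 by commutation with [x]. *)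
Lemma peirce10 x y : c ** x = x -> c ** y = 0 -> x ** y = 0.
Proof.
move=> cx cy; have := peirce0_opcomm cy x; rewrite cx (jmulC A y x) => <-.
by rewrite (peirce1_opcomm cx) cy jmul0r.
Qed.

Lemma peirce11 x y : c ** x = x -> c ** y = y -> c ** (x ** y) = x ** y.
Proof. by move=> cx cy; rewrite (peirce1_opcomm cx) cy. Qed.

(** Excludes the eigenvalue 1/2: [u ** u] only has components for 1 and 0. *)
Lemma peirce_hh u : c ** u = 2^-1 *: u -> c ** (c ** (u ** u)) = c ** (u ** u).
Proof.
move=> cu; have := jordan_linearized u c c.
rewrite ![u ** c]jmulC hc !cu !jmulE ![_ ** c]jmulC !cu => ->.
by apply: jip_inj => t; rewrite !jmulE !jipE; field.
Qed.

Lemma peirce_orth a b x y : c ** x = a *: x -> c ** y = b *: y -> a != b ->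
  ip x y = 0.
Proof.
move=> cx cy ab; have := jip_selfadjoint c x y; rewrite cx cy !jipE => h.
by apply: (mulfI (_ : a - b != 0)); [rewrite subr_eq0 | rewrite mulrBl h; ring].
Qed.

(** For [x] an idempotent orthogonal to [c], this places [c ** (x ** z)], the part of [z] that
    couples the two, in the half space of [c]. *)
Lemma peirce_half_orth x z : c ** x = 0 ->
  c ** (c ** (x ** z)) = 2^-1 *: (c ** (x ** z)).
Proof.
move=> cx; have := jordan_linearized c x z.
rewrite hc cx jmul0r jmul0l => h; apply: jip_inj => t.
move: h => /(congr1 (ip^~ t)); rewrite !jipE ![_ ** x]jmulC.
rewrite -(peirce0_opcomm cx) => h; lra.
Qed.

Section Power.
Variable y : E.
Hypothesis cy : c ** y = y.
Local Notation pw := (fun n => iter n (jmul A y) c).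

(** Power associativity in operator form, with [c] as unit for [y]. The linearized identity
    expresses multiplication by the power [n + 3] through those by [y], [y ** y] and the powers
    [n + 1] and [n + 2]. *)
Lemma opcomm_power n : opcomm (pw n) y /\ opcomm (pw n) (y ** y).
Proof.
have [m] := ubnP n; elim: m n => // m IHm n; rewrite ltnS => lenm.
case: n lenm => [|[|[|n]]] lenm /=.
- by split; apply: peirce1_opcomm => //; apply: peirce11.
- by rewrite [y ** c]jmulC cy; split => z //; rewrite jmul_jordan.
- by rewrite [y ** c]jmulC cy; split => z //; rewrite jmul_jordan.
have [a1 a2] := IHm n.+1 (ltnW lenm); have [b1 b2] := IHm n.+2 lenm.
rewrite /= in a1 a2 b1 b2.
set a := y ** iter n (jmul A y) c in a1 a2 b1 b2 *.
have y2 : opcomm y (y ** y) by move=> z; rewrite jmul_jordan.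
have e3 z : y ** (y ** a) ** z = y ** y ** (a ** z) + 2 *: ((y ** a) ** (y ** z))
    - 2 *: (y ** (a ** (y ** z))).
  rewrite (_ : y ** (y ** a) = y ** y ** a); last first.
    have -> : a = iter n.+1 (jmul A y) c by [].
    have H k : y ** y ** iter k (jmul A y) c = y ** (y ** iter k (jmul A y) c).
      elim: k => [|k IHk] /=; last by rewrite -y2 IHk.
      by rewrite ![_ ** c]jmulC cy peirce11.
    by rewrite H.
  by rewrite jordan_linearized [y ** z ** (y ** a)]jmulC [y ** z ** a]jmulC.
split => z; rewrite !e3.
- by rewrite !jmulE !a1 !b1 !y2.
- by rewrite !jmulE !y2 !a2 !b2 !y2.
Qed.

End Power.

End Idempotent.

End Peirce.

(** * Primitive idempotents and the spectral theorem *)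

Lemma perm_pairwise (T : eqType) (r : rel T) : ssrbool.symmetric r ->
  forall s t, perm_eq s t -> pairwise r s = pairwise r t.
Proof.
move=> rs; suff H s t : perm_eq s t -> pairwise r s -> pairwise r t.
  by move=> s t st; apply/idP/idP; apply: H; rewrite // perm_sym.
apply: (catCA_perm_ind (P := fun s => is_true (pairwise r s))) => s1 s2 s3.
rewrite !pairwise_cat !allrel_catr => /and5P[/andP[a12 ->] -> -> -> ->].
rewrite !andbT allrelC; apply: etrans a12; apply: eq_allrel => x y.
by rewrite rs.
Qed.

Section Spectral.
Variables (R : realType) (E : vectType R) (A : euclidean_jordan_algebra E).
Local Notation "x ** y" := (jmul A x y) (at level 40, left associativity).
Local Notation ip := (jip A).
Local Notation e := (junit A).
Implicit Types (x y z u v w c d p : E) (a b : R).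

(** The eigencomponents [W a] of [c] under multiplication by [y] are polynomials in [y], so they
    commute with [y] as operators. Computing [y ** (W a ** W b)] in two ways gives orthogonality;
    expanding [c] in [c ** W a = W a] then gives idempotency. *)
Lemma idem_spectral c y : jidempotent A c -> c ** y = y ->
  exists (s : seq R) (w : R -> E),
    [/\ uniq s, c = \sum_(a <- s) w a,
        {in s &, forall a b, a != b -> w a ** w b = 0},
        forall a, a \in s -> jidempotent A (w a) &
        forall a, a \in s -> y ** w a = a *: w a].
Proof.
move=> hc cy.
have [s [w [us cw Tw]]] := selfadjoint_eigen_split (jip_gt0 A)
  (T := [the {linear E -> E} of jmul A y]) (jip_selfadjoint A y) c.
pose W a := polyact [the {linear E -> E} of jmul A y] (w a) c.
have yW a : a \in s -> y ** W a = a *: W a := Tw a.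
have Wcomm a : opcomm A (W a) y /\ c ** W a = W a.
  rewrite /W /polyact; elim/big_ind: _ => [|u v [u1 u2] [v1 v2]|i _].
  - by split; [move=> z; rewrite !jmul0l jmul0r | rewrite jmul0r].
  - by split; [rewrite -[u]scale1r; apply: opcommZDl | rewrite jmulDr u2 v2].
  - split; first by rewrite -[_ *: _]addr0; apply: opcommZDl (opcomm_power hc cy i).1 _ => z;
      rewrite !jmul0l jmul0r.
    rewrite jmulZr; congr (_ *: _); elim: (nat_of_ord i) => //= k IHk.
    by rewrite (peirce1_opcomm hc cy) IHk.
have Worth : {in s &, forall a b, a != b -> W a ** W b = 0}.
  move=> a b sa sb ab.
  have h1 := (Wcomm a).1 (W b); have h2 := (Wcomm b).1 (W a).
  rewrite (yW b) // jmulZr in h1; rewrite (yW a) // jmulZr (jmulC A (W b)) in h2.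
  apply: (scalerI (_ : a - b != 0)); first by rewrite subr_eq0.
  by rewrite scaler0 scalerBl h1 h2 subrr.
exists s, W; split => // a sa.
rewrite /jidempotent -{3}(Wcomm a).2 cw jmul_suml (bigD1_seq a) //= big1_seq ?addr0 //.
by move=> b /andP[ba sb]; apply: Worth.
Qed.

Lemma primitive_idem c : jprimitive A c -> jidempotent A c.
Proof. by case. Qed.

Lemma primitive_neq0 c : jprimitive A c -> c != 0.
Proof. by case. Qed.

Lemma idem_sub c d : jidempotent A c -> jidempotent A d -> c ** d = d ->
  jidempotent A (c - d) /\ d ** (c - d) = 0.
Proof.
rewrite /jidempotent => hc hd cd; rewrite !jmulE hc hd (jmulC A d) cd !subrr.
by rewrite addr0.
Qed.

(** The spectral idempotents of [y] sum to [c], so by primitivity a nonzero one is all of [c]. *)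
Lemma primitive_peirce1 c y : jprimitive A c -> c ** y = y ->
  exists a, y = a *: c.
Proof.
move=> pc cy; have hc := primitive_idem pc.
have [s [w [us cw Worth Widem yW]]] := idem_spectral hc cy.
have [a sa wa0] : exists2 a, a \in s & w a != 0.
  apply: contrapT => H; case/negP: (primitive_neq0 pc); rewrite cw big1_seq //.
  by move=> a /andP[_ sa]; apply/eqP/negPn/negP => h; apply: H; exists a.
have cwa : c ** w a = w a.
  rewrite {1}cw jmul_suml (bigD1_seq a) //= big1_seq ?addr0 ?Widem //.
  by move=> b /andP[ba sb]; apply: Worth.
have [h1 h2] := idem_sub hc (Widem a sa) cwa.
have wac : w a = c.
  apply/eqP; rewrite eq_sym -subr_eq0; apply/negPn/negP => h3.
  case: pc => _ _ []; exists (w a), (c - w a); split; first by split => //; apply: Widem.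
  by split=> //; rewrite addrC subrK.
by exists a; rewrite -cy jmulC -wac yW.
Qed.

Definition primitive_family p (l : seq E) :=
  [/\ forall c, c \in l -> jprimitive A c,
      pairwise (fun c d => c ** d == 0) l & \sum_(c <- l) c = p].

Lemma orth_symmetric : ssrbool.symmetric (fun c d => c ** d == 0).
Proof. by move=> c d; rewrite jmulC. Qed.

Lemma orth_family_mul (l : seq E) c : (forall d, d \in l -> jidempotent A d) ->
  pairwise (fun c d => c ** d == 0) l -> c \in l -> (\sum_(d <- l) d) ** c = c.
Proof.
move=> il pl cl; have := perm_to_rem cl => pml.
rewrite (perm_big _ pml) big_cons jmulDl il // jmul_suml big1_seq ?addr0 //.
move=> d /andP[_ dl]; rewrite (perm_pairwise orth_symmetric pml) in pl.
by move: pl; rewrite pairwise_cons => /andP[/allP/(_ d dl)/eqP + _]; rewrite jmulC.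
Qed.

Lemma orth_idem_size (l : seq E) :
  (forall c, c \in l -> jidempotent A c /\ c != 0) ->
  pairwise (fun c d => c ** d == 0) l -> (size l <= \dim (fullv : {vspace E}))%N.
Proof.
move=> il pl.
suff /eqP <- : free (in_tuple l) by apply: dimvS; apply: subvf.
apply/freeP => k; rewrite /= => kl i.
have li : l`_i \in l by rewrite mem_nth.
have := congr1 (jmul A l`_i) kl; rewrite jmul0r jmul_sumr (bigD1 i) //=.
rewrite big1 ?addr0; last first.
  move=> j ji; rewrite jmulZr.
  have orth (u v : nat) : (u < v < size l)%N -> l`_u ** l`_v = 0.
    by case/andP => uv vl; apply/eqP; apply: (pairwiseP 0 pl) => //; apply: ltn_trans vl.
  have [ij | ij | ij] := ltngtP i j.
  - by rewrite orth ?scaler0 // ij /=.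
  - by rewrite jmulC orth ?scaler0 // ij /=.
  - by case/eqP: ji; apply/val_inj.
rewrite jmulZr (il _ li).1 => /eqP; rewrite scaler_eq0 => /orP[/eqP // | h].
by have := (il _ li).2; rewrite h.
Qed.

(** Orthogonal families of nonzero idempotents are free, so one of maximal length exists, and none
    of its members can be split further. *)
Lemma primitive_decomposition p : jidempotent A p ->
  exists l, primitive_family p l.
Proof.
move=> hp.
pose Q n := `[< exists l : seq E, [/\ size l = n,
  forall c, c \in l -> jidempotent A c /\ c != 0,
  pairwise (fun c d => c ** d == 0) l & \sum_(c <- l) c = p] >].
have [| n /asboolP[l [nl il pl sl]]|n /asboolP[l [nl il pl sl]] nmax] :=
  @ex_maxnP Q (\dim (fullv : {vspace E})).
- have [p00 | p0] := eqVneq p 0.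
    by exists 0%N; apply/asboolP; exists [::]; rewrite big_nil p00.
  exists 1%N; apply/asboolP; exists [:: p]; rewrite big_seq1; split => // c.
  by rewrite inE => /eqP->.
- by rewrite -nl; apply: orth_idem_size.
exists l; split => // c cl; split; [exact: (il _ cl).1 | exact: (il _ cl).2 |].
case=> c1 [c2 [[h1 h2 n1 n2] [c12 cE]]].
have := perm_to_rem cl; set l' := rem c l => pml.
suff : (n < n)%N by rewrite ltnn.
apply: nmax; apply/asboolP; exists [:: c1, c2 & l']; split.
- by rewrite /= -nl (perm_size pml).
- move=> d; rewrite !inE => /or3P[/eqP-> // | /eqP-> // | dl'].
  by apply: il; rewrite (perm_mem pml) inE dl' orbT.
- move: pl; rewrite (perm_pairwise orth_symmetric pml) !pairwise_cons => /andP[al ->].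
  have hc := (il _ cl).1.
  (* The two pieces lie in the Peirce 1-space of [c], the other members in its 0-space. *)
  rewrite /= c12 eqxx /= andbT; apply/andP; split; apply/allP => d dl';
    apply/eqP; apply: (peirce10 hc); try exact/eqP/(allP al).
  + by rewrite cE jmulDl h1 (jmulC A c2) c12 addr0.
  + by rewrite cE jmulDl h2 c12 add0r.
- by rewrite !big_cons addrA -cE -sl (perm_big _ pml) big_cons.
Qed.


(* [v] below is the quadratic representation of [d] at [c]; it lies in the
   Peirce 1-space of [d], hence is a multiple of [d], and pairing it with [c]
   and with [d] determines the factor in two ways. *)
Lemma primitive_jip_eq c d : jprimitive A c -> jprimitive A d -> ip c d != 0 ->
  ip c c = ip d d.
Proof.
move=> pc pd; have hc := primitive_idem pc; have hd := primitive_idem pd.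
have [d1 [u [w [cd1 cu cw dE]]]] := peirce_split hc d.
have [a d1E] := primitive_peirce1 pc cd1.
have n0 := jip_gt0 A (primitive_neq0 pc).
have uc0 : ip u c = 0.
  have cc : c ** c = 1 *: c by rewrite scale1r.
  by apply: (peirce_orth cu cc); rewrite invr_eq1 pnatr_eq1.
have wc0 : ip w c = 0.
  have cc : c ** c = 1 *: c by rewrite scale1r.
  have cw0 : c ** w = 0 *: w by rewrite scale0r.
  by apply: (peirce_orth cw0 cc); rewrite eq_sym oner_eq0.
have cdE : ip c d = a * ip c c.
  by rewrite dE jipDr jipDr d1E jipZr (jipC A c u) (jipC A c w) uc0 wc0 !addr0.
have cdcd : c ** d = a *: c + 2^-1 *: u.
  by rewrite dE !jmulE d1E jmulZr hc cu cw addr0.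
pose v := 2 *: (d ** (d ** c)) - d ** c.
have dv : d ** v = v.
  have := idem_cubic hd c; rewrite /v => h; apply: jip_inj => t.
  by move: h => /(congr1 (ip^~ t)); rewrite !jmulE !jipE => h; lra.
have [b vE] := primitive_peirce1 pd dv.
have vd : ip v d = ip c d.
  have dcd : ip (d ** c) d = ip c d by rewrite jip_selfadjoint hd.
  by rewrite /v jipDl jipNl jipZl jip_selfadjoint hd dcd; ring.
have dcc : ip (d ** c) c = ip c d by rewrite jip_assoc hc jipC.
have sq : ip (c ** d) (c ** d) = ip (d ** (d ** c)) c.
  by rewrite [RHS]jip_selfadjoint (jmulC A d c).
have sqE : ip (c ** d) (c ** d) = a ^+ 2 * ip c c + 4^-1 * ip u u.
  by rewrite cdcd !jipE (jipC A c u) uc0; field.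
have sq2 : 2 * ip (c ** d) (c ** d) = ip c d + a ^+ 2 * ip c c.
  rewrite sqE; have : ip (d ** d) c = ip c d by rewrite hd jipC.
  rewrite jip_selfadjoint (jmulC A d c) cdcd {1}dE d1E !jipE uc0 wc0.
  have -> : ip w u = 0.
    have cw0 : c ** w = 0 *: w by rewrite scale0r.
    by apply: (peirce_orth cw0 cu); rewrite eq_sym invr_eq0 pnatr_eq0.
  by rewrite (jipC A c u) uc0 => h; lra.
have vc : ip v c = a ^+ 2 * ip c c.
  by rewrite /v jipDl jipNl jipZl -sq sq2 dcc; ring.
rewrite vE !jipE (jipC A d c) cdE in vc vd.
rewrite cdE => h; have a0 : a != 0 by apply: contra_neq h => ->; rewrite mul0r.
have ab : b = a.
  apply: (mulIf (_ : a * ip c c != 0)); first by rewrite mulf_neq0 // gt_eqF.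
  by rewrite vc; ring.
by apply: (mulfI a0); rewrite -vd ab.
Qed.

Lemma unit_idem : jidempotent A e. Proof. exact: jmul1. Qed.

Lemma family_mul (p : E) l c : primitive_family p l -> c \in l -> p ** c = c.
Proof.
move=> [pl ol <-] cl; apply: orth_family_mul => // d /pl; exact: primitive_idem.
Qed.

Lemma family_flatten (I : eqType) (s : seq I) (w : I -> E) (L : I -> seq E) :
  uniq s -> {in s &, forall i j, i != j -> w i ** w j = 0} ->
  (forall i, i \in s -> jidempotent A (w i) /\ primitive_family (w i) (L i)) ->
  primitive_family (\sum_(i <- s) w i) (flatten [seq L i | i <- s]).
Proof.
elim: s => [|a s IHs] /=; first by rewrite big_nil => *; split => //; rewrite big_nil.
case/andP => ans us worth wL; rewrite big_cons.
have [||pl ol sl] := IHs us.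
- by move=> b c bs cs; apply: worth; rewrite inE ?bs ?cs orbT.
- by move=> b bs; apply: wL; rewrite inE bs orbT.
have [ha fa] := wL a (mem_head _ _); have [pa oa sa] := fa.
split.
- by move=> c; rewrite mem_cat => /orP[/pa | /pl].
- rewrite pairwise_cat oa ol !andbT; apply/allrelP => c d cL /flatten_mapP[b bs dL].
  have ab : a != b by apply: contraNneq ans => ->.
  have bs' : b \in a :: s by rewrite inE bs orbT.
  have [hb fb] := wL b bs'.
  apply/eqP; apply: (peirce10 ha (family_mul fa cL)).
  rewrite jmulC; apply: (peirce10 hb (family_mul fb dL)).
  by rewrite jmulC worth ?mem_head.
- by rewrite big_cat /= sa sl.
Qed.

Lemma spectral_list p y : jidempotent A p -> p ** y = y ->
  exists l : seq (R * E), primitive_family p (map snd l) /\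
    y = \sum_(t <- l) t.1 *: t.2.
Proof.
move=> hp py; have [s [w [us pw worth widem yw]]] := idem_spectral hp py.
have /choice[L LP] : forall a, exists l, a \in s -> primitive_family (w a) l.
  move=> a; have [sa | nsa] := boolP (a \in s); last by exists [::].
  by have [l ?] := primitive_decomposition (widem _ sa); exists l.
exists (flatten [seq [seq (a, c) | c <- L a] | a <- s]); split.
  rewrite map_flatten -map_comp pw.
  rewrite (eq_map (_ : _ =1 L)); first by apply: family_flatten => // a sa; split; auto.
  by move=> a /=; rewrite -map_comp map_id.
rewrite big_flatten big_map -{1}py pw jmul_suml; apply: eq_big_seq => a sa.
rewrite big_map /= -scaler_sumr jmulC yw //.
by have [_ _ ->] := LP a sa.
Qed.

(** On the Peirce 1-space of [w a] the combination of the [w] acts as the scalar [a], so each block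
    may be refined by the spectral idempotents of [w a ** y] alone. *)
Lemma joint_spectral_list (s : seq R) (w : R -> E) y :
  uniq s -> {in s &, forall a b, a != b -> w a ** w b = 0} ->
  (forall a, a \in s -> jidempotent A (w a)) ->
  (forall a, a \in s -> w a ** (w a ** y) = w a ** y) ->
  exists l : seq ((R * R) * E), [/\ primitive_family (\sum_(a <- s) w a) (map snd l),
    \sum_(a <- s) a *: w a = \sum_(t <- l) t.1.1 *: t.2 &
    \sum_(a <- s) w a ** y = \sum_(t <- l) t.1.2 *: t.2].
Proof.
move=> us worth widem wy.
have /choice[L LP] : forall a, exists l : seq (R * E), a \in s ->
    primitive_family (w a) (map snd l) /\ w a ** y = \sum_(t <- l) t.1 *: t.2.
  move=> a; have [sa | nsa] := boolP (a \in s); last by exists [::].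
  by have [l ?] := spectral_list (widem _ sa) (wy _ sa); exists l.
exists (flatten [seq [seq ((a, t.1), t.2) | t <- L a] | a <- s]); split.
- rewrite map_flatten -map_comp.
  rewrite (eq_map (_ : _ =1 (fun a => map snd (L a)))).
    by apply: family_flatten => // a sa; split; [auto | case: (LP a sa)].
  by move=> a /=; rewrite -map_comp.
- rewrite big_flatten big_map; apply: eq_big_seq => a sa.
  rewrite big_map /= -scaler_sumr -(big_map snd predT id) /=.
  by have [[_ _ ->]] := LP a sa.
- rewrite big_flatten big_map; apply: eq_big_seq => a sa.
  by rewrite big_map /=; have [] := LP a sa.
Qed.

(* The trace is represented by a vector [q] for the given associative form. *)
Lemma trace_vector : exists q, (forall d, jprimitive A d -> ip q d = 1) /\
  forall x, opcomm A x q.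
Proof.
pose Q l : E := \sum_(c <- l) (ip c c)^-1 *: c.
have Qprim l d : primitive_family e l -> jprimitive A d -> ip (Q l) d = 1.
  move=> [pl ol sl] pd; have dd0 := jip_gt0 A (primitive_neq0 pd).
  have -> : ip (Q l) d = \sum_(c <- l) (ip d d)^-1 * ip c d.
    (* Terms with [ip c d] nonzero have [ip c c = ip d d], so one common weight can be taken out of
       the sum. *)
    rewrite /Q linear_sumlz; apply: eq_big_seq => c cl; rewrite jipZl.
    have [-> | cd0] := eqVneq (ip c d) 0; first by rewrite !mulr0.
    by rewrite (primitive_jip_eq (pl _ cl) pd cd0).
  rewrite -mulr_sumr -linear_sumlz sl -{3}(primitive_idem pd) -jip_assoc jmul1.
  by rewrite mulVf // gt_eqF.
have span x z : (forall d, jprimitive A d -> ip x d = ip z d) -> x = z.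
  move=> h; apply: (@jip_inj _ _ A) => y.
  have [l [[pl _ _] ->]] := spectral_list unit_idem (jmul1 A y).
  rewrite !linear_sumr; apply: eq_big_seq => t tl; rewrite /= !jipZr h //.
  by apply: pl; apply: map_f.
have [l0 fl0] := primitive_decomposition unit_idem.
exists (Q l0); split; first by move=> d; apply: Qprim.
(* The vector does not depend on the family, as primitive idempotents span; a family containing [c]
   makes the commutation visible. *)
have key c : jprimitive A c -> opcomm A c (Q l0).
  move=> pc; have hc := primitive_idem pc.
  have [hec cec] := idem_sub unit_idem hc (jmul1 A c).
  have [l' fl'] := primitive_decomposition hec.
  have [pl' ol' sl'] := fl'.
  have cl' d : d \in l' -> c ** d = 0.
    move=> dl'; have := family_mul fl' dl'; rewrite jmulBl jmul1.
    by rewrite -[X in _ = X]subr0 => /addrI/oppr_inj.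
  have fl : primitive_family e (c :: l').
    split.
    - by move=> d; rewrite inE => /orP[/eqP-> // | /pl'].
    - by rewrite pairwise_cons ol' andbT; apply/allP => d /cl' ->.
    - by rewrite big_cons sl' addrC subrK.
  have -> : Q l0 = Q (c :: l').
    by apply: span => d pd; rewrite !Qprim.
  apply: opcomm_sym; rewrite /Q big_seq; elim/big_ind: _ => [z|u v hu hv z|d].
  - by rewrite !jmul0l jmul0r.
  - by rewrite !jmulDl jmulDr hu hv.
  - rewrite inE => /orP[/eqP-> | dl'] z; rewrite !jmulZl jmulZr //.
    by rewrite (peirce0_opcomm hc (cl' _ dl')).
move=> x; have [l [[pl _ _] ->]] := spectral_list unit_idem (jmul1 A x).
rewrite big_seq; elim/big_ind: _ => [z|u v hu hv z|t tl z].
- by rewrite !jmul0l jmul0r.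
- by rewrite !jmulDl jmulDr hu hv.
- by rewrite !jmulZl jmulZr key //; apply: pl; apply: map_f.
Qed.

End Spectral.

(** * Rearrangement and joint diagonalization *)

Section Rearrangement.
Variable R : realFieldType.

(** [B] is the discrete integral of [a] against [b], and [a] acts as its subgradient. Summed over a
    permutation the right-hand sides cancel: this is cyclic monotonicity. *)
Lemma rearrangement_potential (n : nat) (a b : nat -> R) :
  (forall i j, (i <= j < n)%N -> a j <= a i) ->
  (forall i j, (i <= j < n)%N -> b j <= b i) ->
  exists B : nat -> R, forall i j, (i < n)%N -> (j < n)%N ->
    a i * (b j - b i) <= B j - B i.
Proof.
move=> am bm; pose B j := \sum_(k < j) a k * (b k.+1 - b k).
have BS j : B j.+1 = B j + a j * (b j.+1 - b j) by rewrite /B big_ord_recr.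
have key i k : (i + k < n)%N -> a i * (b (i + k)%N - b i) <= B (i + k)%N - B i /\
    a (i + k)%N * (b i - b (i + k)%N) <= B i - B (i + k)%N.
  elim: k => [|k IHk]; first by rewrite addn0 !subrr !mulr0.
  rewrite addnS => lt; have [h1 h2] := IHk (ltnW lt); rewrite BS.
  have a1 : a (i + k)%N <= a i by apply: am; rewrite leq_addr ltnW.
  have a2 : a (i + k).+1 <= a (i + k)%N by apply: am; rewrite leqnSn.
  have b1 : b (i + k)%N <= b i by apply: bm; rewrite leq_addr ltnW.
  have b2 : b (i + k).+1 <= b (i + k)%N by apply: bm; rewrite leqnSn.
  by split; nra.
exists B => i j li lj; have [ij | /ltnW ji] := leqP i j.
  by have := (key i (j - i)%N); rewrite subnKC // => /(_ lj)[].
by have := (key j (i - j)%N); rewrite subnKC // => /(_ li)[].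
Qed.

Definition nonincreasing_col n (a : 'I_n -> R) :=
  forall i j : 'I_n, (i <= j)%N -> a j <= a i.

Lemma rearrangement n (a b : 'I_n -> R) (s : {perm 'I_n}) :
  nonincreasing_col a -> nonincreasing_col b ->
  \sum_i a i * b (s i) <= \sum_i a i * b i.
Proof.
move=> am bm.
pose ext (f : 'I_n -> R) k := if insub k is Some i then f i else 0.
have extE f (i : 'I_n) : ext f i = f i by rewrite /ext valK.
have extm f : nonincreasing_col f ->
    forall i j, (i <= j < n)%N -> ext f j <= ext f i.
  move=> fm i j /andP[ij jn]; have := fm (Ordinal (leq_ltn_trans ij jn)) (Ordinal jn) ij.
  by rewrite -!extE.
have [B BP] := rearrangement_potential (extm _ am) (extm _ bm).
have : \sum_i (a i * b (s i) - a i * b i) <= \sum_i (B (s i) - B i).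
  apply: ler_sum => i _; have := BP i (s i) (ltn_ord _) (ltn_ord _).
  by rewrite !extE mulrBr.
have eB : \sum_(i < n) B i = \sum_i B (s i) by rewrite (reindex_inj (@perm_inj _ s)).
by rewrite !big_split !sumrN /= eB subrr subr_le0.
Qed.

Lemma nonincreasing_perm_eq n (a b : 'I_n -> R) (s : {perm 'I_n}) :
  nonincreasing_col a -> nonincreasing_col b -> (forall i, a i = b (s i)) -> a =1 b.
Proof.
move=> am bm abs.
have h := rearrangement s am bm.
have sq : \sum_i b i ^+ 2 = \sum_i a i ^+ 2.
  rewrite (reindex_inj (@perm_inj _ s)); by apply: eq_bigr => i _; rewrite abs.
have sq2 : \sum_i a i * b (s i) = \sum_i a i ^+ 2.
  by apply: eq_bigr => i _; rewrite -abs expr2.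
have d0 : \sum_i (a i - b i) ^+ 2 <= 0.
  have -> : \sum_i (a i - b i) ^+ 2 =
      \sum_i a i ^+ 2 + \sum_i b i ^+ 2 - 2 * \sum_i a i * b i.
    by rewrite mulr_sumr -sumrN -!big_split; apply: eq_bigr => i _ /=; ring.
  by rewrite sq; rewrite sq2 in h; lra.
have d1 : \sum_i (a i - b i) ^+ 2 == 0.
  by rewrite eq_le d0 sumr_ge0 // => i _; apply: sqr_ge0.
move=> i; apply/eqP; rewrite -subr_eq0 -sqrf_eq0; apply/eqP.
by move/eqP: d1 => /psumr_eq0P -> // j _; apply: sqr_ge0.
Qed.

End Rearrangement.

Section JointFrames.
Variables (R : realType) (E : vectType R) (A : euclidean_jordan_algebra E).
Local Notation "x ** y" := (jmul A x y) (at level 40, left associativity).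
Local Notation ip := (jip A).
Local Notation e := (junit A).
Implicit Types (x y z u v w c d p : E) (a b : R).

Lemma frame_idem r (J : 'I_r -> E) i : jordan_frame A J -> J i ** J i = J i.
Proof. by case=> [/(_ i)[]]. Qed.

Lemma frame_orth r (J : 'I_r -> E) i j : jordan_frame A J -> i != j -> J i ** J j = 0.
Proof. by case=> _ h _; apply: h. Qed.

Lemma frame_list r (J : 'I_r -> E) : jordan_frame A J ->
  primitive_family A e [seq J i | i <- enum 'I_r].
Proof.
move=> fJ; have [pJ oJ sJ] := fJ; split.
- by move=> c /mapP[i _ ->].
- rewrite pairwise_map; apply: (sub_pairwise (r := fun i j => i != j)).
    by move=> i j ij /=; rewrite oJ.
  by rewrite -uniq_pairwise enum_uniq.
- by rewrite big_map big_enum.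
Qed.

Lemma list_frame (X : eqType) (x0 : X) (l : seq (X * E)) r :
  primitive_family A e (map snd l) -> size l = r ->
  exists (f : 'I_r -> X) (J : 'I_r -> E), [/\ jordan_frame A J,
    (forall i : 'I_r, f i = nth x0 (map fst l) i) &
    forall F : X -> E -> E, \sum_(t <- l) F t.1 t.2 = \sum_i F (f i) (J i)].
Proof.
move=> [pl ol sl] sz; exists (fun i => (nth (x0, 0) l i).1), (fun i => (nth (x0, 0) l i).2).
have FE (F : X -> E -> E) : \sum_(t <- l) F t.1 t.2 =
    \sum_(i < r) F (nth (x0, 0) l i).1 (nth (x0, 0) l i).2.
  by rewrite (big_nth (x0, 0)) sz big_mkord.
have JE (i : nat) : (i < r)%N -> (nth (x0, 0) l i).2 = nth 0 (map snd l) i.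
  by move=> ir; rewrite (nth_map (x0, 0)) ?sz.
split=> //.
- split.
  + by move=> i; apply: pl; rewrite JE // mem_nth // size_map sz.
  + move=> i j ij.
    have H (k m : 'I_r) : (k < m)%N ->
        (nth (x0, 0) l k).2 ** (nth (x0, 0) l m).2 = 0.
      move=> km; rewrite !JE //; apply/eqP; apply: (pairwiseP 0 ol) => //=;
      by rewrite inE size_map sz.
    have [ltij | ltji | eij] := ltngtP i j; [exact: H | by rewrite jmulC H |].
    by case/eqP: ij; apply: val_inj.
  + by rewrite -sl big_map (FE (fun _ c => c)).
- by move=> i; rewrite (nth_map (x0, 0)) // sz.
Qed.

Lemma perm_family p (l l' : seq E) : perm_eq l l' ->
  primitive_family A p l -> primitive_family A p l'.
Proof.
move=> ll' [pl ol sl]; split.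
- by move=> c; rewrite -(perm_mem ll'); apply: pl.
- by rewrite -(perm_pairwise (orth_symmetric A) ll').
- by rewrite -(perm_big _ ll').
Qed.

Lemma sorted_frame (l : seq ((R * R) * E)) r :
  primitive_family A e (map snd l) -> size l = r ->
  exists (J : 'I_r -> E) (a b : 'I_r -> R), [/\ jordan_frame A J, nonincreasing_col a,
    \sum_(t <- l) t.1.1 *: t.2 = \sum_i a i *: J i &
    \sum_(t <- l) t.1.2 *: t.2 = \sum_i b i *: J i].
Proof.
move=> fl sz; pose le (s t : (R * R) * E) := t.1.1 <= s.1.1.
have pl : perm_eq l (sort le l) by rewrite perm_sym perm_sort.
have fl' := perm_family (perm_map snd pl) fl.
have sz' : size (sort le l) = r by rewrite size_sort.
have [f [J [fJ fE FE]]] := list_frame (0, 0) fl' sz'.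
exists J, (fun i => (f i).1), (fun i => (f i).2); split => //.
- move=> i j ij; rewrite !fE !(nth_map (0, 0, 0)) ?sz' //.
  have le_tr : transitive le by move=> t s u ts su; apply: le_trans su ts.
  have le_rf : reflexive le by move=> s; apply: lexx.
  have so : sorted le (sort le l) by apply: sort_sorted => s t; apply: le_total.
  by apply: (sorted_leq_nth le_tr le_rf _ so) => //; rewrite inE sz'.
- by rewrite (perm_big _ pl) /= (FE (fun t c => t.1 *: c)).
- by rewrite (perm_big _ pl) /= (FE (fun t c => t.2 *: c)).
Qed.

(** The vectors [w a ** y] are eigenvectors of multiplication by [x] for distinct eigenvalues, hence
    orthogonal. The mixed component lies in both half spaces, so its squared length is a quarter of
    such an inner product. *)
Lemma opcomm_peirce_orth (s : seq R) (w : R -> E) x y :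
  x = \sum_(a <- s) a *: w a -> (forall a, a \in s -> jidempotent A (w a)) ->
  {in s &, forall a b, a != b -> w a ** w b = 0} ->
  uniq s -> opcomm A x y ->
  {in s &, forall a b, a != b -> w a ** (w b ** y) = 0}.
Proof.
move=> xE hw ow us xy a b sa sb ab.
have xw a' : a' \in s -> x ** w a' = a' *: w a'.
  move=> sa'; rewrite xE jmul_suml (bigD1_seq a') //= big1_seq ?addr0.
    by rewrite jmulZl hw.
  by move=> b' /andP[ba' sb']; rewrite jmulZl ow ?scaler0.
have xwy a' : a' \in s -> x ** (w a' ** y) = a' *: (w a' ** y).
  by move=> sa'; rewrite (jmulC A (w a')) xy xw // jmulZr.
have o : ip (w a ** y) (w b ** y) = 0.
  have := jip_selfadjoint A x (w a ** y) (w b ** y).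
  rewrite !xwy // !jipE => h; apply: (mulfI (_ : a - b != 0)).
    by rewrite subr_eq0.
  by rewrite mulrBl h; ring.
have oc := peirce0_opcomm (hw a sa) (ow a b sa sb ab).
pose u := w a ** (w b ** y).
have uE : u = w b ** (w a ** y) by rewrite /u oc.
have au : w a ** u = 2^-1 *: u by apply: peirce_half_orth; [apply: hw | apply: ow].
have bu : w b ** u = 2^-1 *: u.
  by rewrite uE; apply: peirce_half_orth; [apply: hw | apply: ow; rewrite // eq_sym].
apply: (@jip_eq0 _ _ A); rewrite -/u {1}/u jip_selfadjoint au jipZr jip_selfadjoint.
by rewrite bu jipZr /u -jip_selfadjoint o !mulr0.
Qed.

End JointFrames.

(** * The trace inner product *)

Section TraceForm.
Variables (R : realType) (E : vectType R) (A : euclidean_jordan_algebra E).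
Variables (r : nat) (hr : has_rank A r).
Local Notation "x ** y" := (jmul A x y) (at level 40, left associativity).
Local Notation ip := (jip A).
Local Notation e := (junit A).
Local Notation tr := (trip A r).
Local Notation lam x := (fun i => eigvals A r x i 0).
Implicit Types (x y z u v w c d p : E) (a b : R) (J : 'I_r -> E).

Lemma family_size l : primitive_family A e l -> size l = r.
Proof.
have [q [q1 _]] := trace_vector A; have [J0 /frame_list fJ0] := hr.
have H l' : primitive_family A e l' -> ip q e = (size l')%:R.
  move=> [pl _ <-]; rewrite linear_sumr -sum1_size natr_sum.
  by apply: eq_big_seq => c /pl; apply: q1.
move=> /H; rewrite (H _ fJ0) size_map size_enum_ord => /eqP.
by rewrite eqr_nat => /eqP.
Qed.

Lemma split_frame (s : seq R) (w : R -> E) y :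
  uniq s -> {in s &, forall a b, a != b -> w a ** w b = 0} ->
  (forall a, a \in s -> jidempotent A (w a)) -> \sum_(a <- s) w a = e ->
  {in s &, forall a b, a != b -> w a ** (w b ** y) = 0} ->
  exists J (a b : 'I_r -> R), [/\ jordan_frame A J, nonincreasing_col a,
    \sum_(a <- s) a *: w a = \sum_i a i *: J i & y = \sum_i b i *: J i].
Proof.
move=> us ow hw sw wy.
have yE : y = \sum_(a <- s) w a ** y by rewrite -jmul_suml sw jmul1.
have wwy a : a \in s -> w a ** (w a ** y) = w a ** y.
  move=> sa; rewrite [in RHS]yE jmul_sumr (bigD1_seq a) //= big1_seq ?addr0 //.
  by move=> b /andP[ba sb]; apply: wy; rewrite // eq_sym.
have [l [fl xl yl]] := joint_spectral_list us ow hw wwy.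
rewrite sw in fl; have sz := family_size fl; rewrite size_map in sz.
have [J [a [b [fJ am xE yE']]]] := sorted_frame fl sz.
by exists J, a, b; split; rewrite // ?xl // yE yl.
Qed.

Lemma opcomm_frame x y : opcomm A x y ->
  exists J (a b : 'I_r -> R), [/\ jordan_frame A J, nonincreasing_col a,
    x = \sum_i a i *: J i & y = \sum_i b i *: J i].
Proof.
move=> xy; have [s [w [us sw ow hw xw]]] := idem_spectral (unit_idem A) (jmul1 A x).
have xE : x = \sum_(a <- s) a *: w a.
  rewrite -[LHS](jmul1r A) sw jmul_sumr; exact: eq_big_seq.
have wy := opcomm_peirce_orth xE hw ow us xy.
by have := split_frame us ow hw (esym sw) wy; rewrite -xE.
Qed.

Lemma eigvals_frame x : nonincreasing_col (lam x) /\
  exists2 J, jordan_frame A J & x = \sum_i eigvals A r x i 0 *: J i.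
Proof.
have xx : opcomm A x x by [].
have [J [a [_ [fJ am xE _]]]] := opcomm_frame xx.
apply: (@xgetPex _ 0 [set a : 'cV[R]_r | nonincreasing_col (fun i => a i 0) /\
    exists2 J, jordan_frame A J & x = \sum_i a i 0 *: J i]).
exists (\col_i a i); split=> [i j ij|]; first by rewrite !mxE; apply: am.
by exists J => //; rewrite xE; apply: eq_bigr => i _; rewrite mxE.
Qed.

Lemma trip_vector : exists q, [/\ (forall d, jprimitive A d -> ip q d = 1),
  (forall x, opcomm A x q) & forall x y, tr x y = ip q (x ** y)].
Proof.
have [q [q1 qc]] := trace_vector A; exists q; split => // x y.
rewrite /trip /jtr; have [_ [J fJ {2}->]] := eigvals_frame (x ** y).
rewrite linear_sumr; apply: eq_bigr => i _.
by rewrite /= jipZr q1 ?mulr1 //; case: fJ.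
Qed.

Lemma tripC x y : tr x y = tr y x.
Proof. by rewrite /trip jmulC. Qed.

Lemma tripDl x y z : tr (x + y) z = tr x z + tr y z.
Proof. by have [q [_ _ trE]] := trip_vector; rewrite !trE jmulDl jipDr. Qed.

Lemma tripZl a x z : tr (a *: x) z = a * tr x z.
Proof. by have [q [_ _ trE]] := trip_vector; rewrite !trE jmulZl jipZr. Qed.

Lemma tripDr x y z : tr z (x + y) = tr z x + tr z y.
Proof. by rewrite !(tripC z) tripDl. Qed.

Lemma tripZr a x z : tr z (a *: x) = a * tr z x.
Proof. by rewrite !(tripC z) tripZl. Qed.

Lemma tripNl x z : tr (- x) z = - tr x z.
Proof. by rewrite -scaleN1r tripZl mulN1r. Qed.

Lemma tripNr x z : tr z (- x) = - tr z x.
Proof. by rewrite !(tripC z) tripNl. Qed.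

Lemma trip0l z : tr 0 z = 0.
Proof. by rewrite -(scale0r 0) tripZl mul0r. Qed.

Lemma trip0r z : tr z 0 = 0.
Proof. by rewrite tripC trip0l. Qed.

Definition tripE := (tripDl, tripDr, tripNl, tripNr, trip0l, trip0r, tripZl, tripZr).

Lemma trip_suml I (s : seq I) (P : pred I) (F : I -> E) z :
  tr (\sum_(i <- s | P i) F i) z = \sum_(i <- s | P i) tr (F i) z.
Proof.
by elim/big_rec2: _ => [|i _ y _ <-]; [rewrite trip0l | rewrite tripDl].
Qed.

Lemma trip_sumr I (s : seq I) (P : pred I) (F : I -> E) z :
  tr z (\sum_(i <- s | P i) F i) = \sum_(i <- s | P i) tr z (F i).
Proof. by rewrite tripC trip_suml; apply: eq_bigr => i _; rewrite tripC. Qed.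

(** With [tr x y = ip q (x ** y)] this amounts to commutation with [q], whence the second clause of
    [trace_vector]. *)
Lemma trip_assoc x y z : tr (x ** y) z = tr x (y ** z).
Proof.
have [q [_ qc trE]] := trip_vector; rewrite !trE.
rewrite (jmulC A (x ** y)) -jip_assoc (jmulC A x y) -jip_assoc (jmulC A _ y) qc.
by rewrite (jmulC A x) -jip_assoc.
Qed.

Lemma trip_selfadjoint x y z : tr (x ** y) z = tr y (x ** z).
Proof. by rewrite jmulC trip_assoc. Qed.

Lemma trip_unit J i : jordan_frame A J -> tr (J i) e = 1.
Proof.
move=> fJ; have [q [q1 _ trE]] := trip_vector.
by rewrite trE jmul1r q1 //; case: fJ.
Qed.

Lemma trip_frame J i j : jordan_frame A J -> tr (J i) (J j) = (i == j)%:R.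
Proof.
move=> fJ; have [-> | ij] := eqVneq i j.
  by rewrite -(trip_unit j fJ) -{3}(frame_idem j fJ) trip_assoc jmul1r.
by have [q [_ _ trE]] := trip_vector; rewrite trE frame_orth // jip0r.
Qed.

Lemma trip_coord J (a : 'I_r -> R) i : jordan_frame A J ->
  tr (J i) (\sum_j a j *: J j) = a i.
Proof.
move=> fJ; rewrite trip_sumr (bigD1 i) //= big1 ?addr0.
  by rewrite tripZr trip_frame // eqxx mulr1.
by move=> j ji; rewrite tripZr trip_frame // eq_sym (negPf ji) mulr0.
Qed.

Lemma trip_frame_sum J (a b : 'I_r -> R) : jordan_frame A J ->
  tr (\sum_i a i *: J i) (\sum_i b i *: J i) = \sum_i a i * b i.
Proof.
by move=> fJ; rewrite trip_suml; apply: eq_bigr => i _; rewrite tripZl trip_coord.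
Qed.

Lemma trip_ge0 x : 0 <= tr x x.
Proof.
have [_ [J fJ ->]] := eigvals_frame x; rewrite trip_frame_sum //.
by apply: sumr_ge0 => i _; rewrite -expr2 sqr_ge0.
Qed.

Lemma trip_eq0 x : tr x x = 0 -> x = 0.
Proof.
have [_ [J fJ xE]] := eigvals_frame x; rewrite {1 2}xE trip_frame_sum // => h.
rewrite xE big1 // => i _; apply/eqP; rewrite scaler_eq0.
apply/orP; left; rewrite -sqrf_eq0 expr2; apply/eqP.
by move/psumr_eq0P: h => -> // j _; rewrite -expr2 sqr_ge0.
Qed.

(** The identity [t = t^2 + 4 (t - t^2)^2] holds at 0, 1/2 and 1, the possible eigenvalues of
    multiplication by [c]. It makes this operator positive and a contraction. *)
Lemma trip_idem c x : jidempotent A c ->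
  tr (c ** x) x = tr (c ** x) (c ** x) + 4 * tr (c ** x - c ** (c ** x)) (c ** x - c ** (c ** x)).
Proof.
move=> hc; pose t n := tr (iter n (jmul A c) x) x.
have tE n m : tr (iter n (jmul A c) x) (iter m (jmul A c) x) = t (n + m)%N.
  elim: n m => [|n IHn] m; first by rewrite tripC.
  by rewrite [iter n.+1 _ _]/= trip_selfadjoint -iterS IHn addnS.
have t3 n : t n.+1 = 3 * t n.+2 - 2 * t n.+3.
  rewrite /t -tripZl -tripZl -tripNl -tripDl; congr (tr _ _).
  exact: idem_cubic.
rewrite !tripE (tE 1 1)%N (tE 1 2)%N (tE 2 1)%N (tE 2 2)%N /= -/(t 1%N).
by have := t3 0%N; have := t3 1%N; rewrite !addnE /=; lra.
Qed.

Lemma trip_idem_ge0 c d : jidempotent A c -> jidempotent A d -> 0 <= tr c d.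
Proof.
move=> hc hd; have -> : tr c d = tr (c ** d) d by rewrite trip_assoc hd.
by rewrite trip_idem // addr_ge0 ?mulr_ge0 ?trip_ge0.
Qed.

Definition frame_gram J J' : 'M[R]_r := \matrix_(i, j) tr (J i) (J' j).

Lemma frame_gram_doubly_stochastic J J' : jordan_frame A J -> jordan_frame A J' ->
  doubly_stochastic (frame_gram J J').
Proof.
move=> fJ fJ'; split.
- by move=> i j; rewrite mxE trip_idem_ge0 // /jidempotent frame_idem.
- move=> i; under eq_bigr do rewrite mxE.
  by rewrite -trip_sumr; have [_ _ ->] := fJ'; apply: trip_unit.
- move=> j; under eq_bigr do rewrite mxE.
  by rewrite -trip_suml; have [_ _ ->] := fJ; rewrite tripC; apply: trip_unit.
Qed.

Lemma gram_dist J J' (a b : 'I_r -> R) : jordan_frame A J -> jordan_frame A J' ->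
  let x := \sum_i a i *: J i - \sum_j b j *: J' j in
  tr x x = \sum_i \sum_j frame_gram J J' i j * (a i - b j) ^+ 2.
Proof.
move=> fJ fJ'; have [D0 Dr Dc] := frame_gram_doubly_stochastic fJ fJ'.
set D := frame_gram _ _ in D0 Dr Dc *.
have abE : tr (\sum_i a i *: J i) (\sum_j b j *: J' j) = \sum_i \sum_j D i j * (a i * b j).
  rewrite trip_suml; apply: eq_bigr => i _; rewrite trip_sumr; apply: eq_bigr => j _.
  by rewrite tripZl tripZr mxE; ring.
have aaE : \sum_i a i * a i = \sum_i \sum_j D i j * (a i ^+ 2).
  by apply: eq_bigr => i _; rewrite -mulr_suml Dr mul1r expr2.
have bbE : \sum_i b i * b i = \sum_i \sum_j D i j * (b j ^+ 2).
  by rewrite exchange_big /=; apply: eq_bigr => j _; rewrite -mulr_suml Dc mul1r expr2.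
have -> : \sum_i \sum_j D i j * (a i - b j) ^+ 2 = \sum_i \sum_j D i j * (a i ^+ 2)
    + \sum_i \sum_j D i j * (b j ^+ 2) - 2 * \sum_i \sum_j D i j * (a i * b j).
  rewrite mulr_sumr -sumrN -!big_split; apply: eq_bigr => i _ /=.
  by rewrite mulr_sumr -sumrN -!big_split; apply: eq_bigr => j _ /=; ring.
move=> x; rewrite /x !tripE (tripC (\sum_j b j *: J' j)) !trip_frame_sum // abE aaE bbE.
ring.
Qed.

(* A linear cost is minimized over the doubly stochastic matrices at a
   permutation.  This bound replaces the compactness of the set of Jordan
   frames when limits of normal vectors are taken. *)
Lemma joint_matching J J' (a v b w : 'I_r -> R) : jordan_frame A J -> jordan_frame A J' ->
  let x := \sum_i a i *: J i - \sum_j b j *: J' j in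
  let y := \sum_i v i *: J i - \sum_j w j *: J' j in
  exists s : {perm 'I_r},
    \sum_i (a i - b (s i)) ^+ 2 + \sum_i (v i - w (s i)) ^+ 2 <= tr x x + tr y y.
Proof.
move=> fJ fJ' x y; rewrite /x /y !gram_dist //.
have [s _ sP] := birkhoff_min (\matrix_(i, j) ((a i - b j) ^+ 2 + (v i - w j) ^+ 2))
  (frame_gram_doubly_stochastic fJ fJ').
exists s; rewrite -!big_split /=; apply: le_trans (le_trans _ sP) _.
  by rewrite le_eqVlt; apply/orP; left; apply/eqP; apply: eq_bigr => i _; rewrite mxE.
apply: ler_sum => i _; rewrite -big_split /=; apply: ler_sum => j _.
by rewrite [in leLHS]mxE -mulrDr mxE.
Qed.

(** Uniqueness of eigenvalues: for two decompositions of one element the bound in [joint_matching]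
    is 0, so the matching is exact. *)
Lemma eigvals_perm J (a : 'I_r -> R) : jordan_frame A J ->
  exists s : {perm 'I_r}, forall i, eigvals A r (\sum_i a i *: J i) i 0 = a (s i).
Proof.
move=> fJ; set x := \sum_i _; have [_ [J' fJ' xE]] := eigvals_frame x.
have [s] := joint_matching (lam x) (lam x) a a fJ' fJ.
rewrite /= -xE subrr trip0l addr0 => h; exists s => i.
have d0 : \sum_i (eigvals A r x i 0 - a (s i)) ^+ 2 == 0.
  rewrite eq_le sumr_ge0 ?andbT => [|k _]; last exact: sqr_ge0.
  by apply: le_trans h; rewrite lerDl sumr_ge0 // => k _; apply: sqr_ge0.
apply/eqP; rewrite -subr_eq0 -sqrf_eq0; apply/eqP.
by move/eqP: d0 => /psumr_eq0P -> // j _; apply: sqr_ge0.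
Qed.

Lemma eigvalsE J (a : 'I_r -> R) i : jordan_frame A J -> nonincreasing_col a ->
  eigvals A r (\sum_i a i *: J i) i 0 = a i.
Proof.
move=> fJ am; have [s sP] := eigvals_perm a fJ.
exact: (nonincreasing_perm_eq (eigvals_frame _).1 am sP).
Qed.

(** [birkhoff_min] bounds the Gram average by its value at a permutation, and [rearrangement] bounds
    that by the sorted pairing. *)
Lemma trip_le_eigvals x y : tr x y <= \sum_i eigvals A r x i 0 * eigvals A r y i 0.
Proof.
have [xm [J fJ xE]] := eigvals_frame x; have [ym [J' fJ' yE]] := eigvals_frame y.
have [s _ sP] := birkhoff_min
  (\matrix_(i, j) - (eigvals A r x i 0 * eigvals A r y j 0))
  (frame_gram_doubly_stochastic fJ fJ').
apply: le_trans (rearrangement s xm ym).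
rewrite {1}xE {1}yE trip_suml -lerN2; apply: le_trans (le_trans _ sP) _.
  by rewrite -sumrN; apply: ler_sum => i _; rewrite mxE.
rewrite -sumrN; apply: ler_sum => i _; rewrite trip_sumr -sumrN; apply: ler_sum => j _.
by rewrite tripZl tripZr !mxE le_eqVlt; apply/orP; left; apply/eqP; ring.
Qed.

Lemma trip_eigvals x : tr x x = \sum_i eigvals A r x i 0 * eigvals A r x i 0.
Proof. by have [_ [J fJ {1 2}->]] := eigvals_frame x; rewrite trip_frame_sum. Qed.

Lemma eigvals_lipschitz x y :
  \sum_i (eigvals A r x i 0 - eigvals A r y i 0) ^+ 2 <= tr (x - y) (x - y).
Proof.
have -> : \sum_i (eigvals A r x i 0 - eigvals A r y i 0) ^+ 2 =
    tr x x + tr y y - 2 * \sum_i eigvals A r x i 0 * eigvals A r y i 0.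
  rewrite !trip_eigvals mulr_sumr -sumrN -!big_split.
  by apply: eq_bigr => i _ /=; ring.
by rewrite !tripE (tripC y x); have := trip_le_eigvals x y; lra.
Qed.

End TraceForm.

(** * Inner products and normal cones *)

Section Convex.
Variables (R : realType) (V : lmodType R).
Implicit Types (B K : set V).

Lemma convex_setP K : @convex_set R V K <->
  forall x y (t : R), K x -> K y -> 0 <= t -> t <= 1 -> K (t *: x + (1 - t) *: y).
Proof.
split=> [cK x y t Kx Ky t0 t1 | cK x y t].
  have t01 : 0 <= t <= 1 by rewrite t0 t1.
  have := cK x y (Itv01 t0 t1); rewrite !inE; exact.
by rewrite !inE => Kx Ky; apply: cK.
Qed.

Lemma conv_hull_convex B : @convex_set R V (conv_hull B).
Proof.
apply/convex_setP => x y t Bx By t0 t1 K [cK BK].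
by move/convex_setP: (cK); apply => //; [apply: Bx | apply: By].
Qed.

Lemma conv_hull_sub B K : @convex_set R V K -> B `<=` K -> conv_hull B `<=` K.
Proof. exact: smallest_sub. Qed.

Lemma sub_conv_hull B : B `<=` conv_hull B.
Proof. exact: sub_gen_smallest. Qed.

End Convex.

Section InnerProduct.
Variables (R : realType) (V : lmodType R) (ip : V -> V -> R).

Record inner_product : Prop := InnerProduct {
  ipC : forall x y, ip x y = ip y x;
  ipDl : forall x y z, ip (x + y) z = ip x z + ip y z;
  ipZl : forall a x z, ip (a *: x) z = a * ip x z;
  ip_ge0 : forall x, 0 <= ip x x;
  ip_eq0 : forall x, ip x x = 0 -> x = 0 }.

Hypothesis hip : inner_product.
Local Notation "`[ x ]" := (ipnorm ip x) (format "`[ x ]").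

Lemma ipDr x y z : ip z (x + y) = ip z x + ip z y.
Proof. by rewrite !(ipC hip z) ipDl. Qed.

Lemma ipZr a x z : ip z (a *: x) = a * ip z x.
Proof. by rewrite !(ipC hip z) ipZl. Qed.

Lemma ipNl x z : ip (- x) z = - ip x z.
Proof. by rewrite -scaleN1r ipZl // mulN1r. Qed.

Lemma ipNr x z : ip z (- x) = - ip z x.
Proof. by rewrite !(ipC hip z) ipNl. Qed.

Lemma ip0l z : ip 0 z = 0.
Proof. by rewrite -(scale0r 0) ipZl // mul0r. Qed.

Lemma ipnorm_ge0 x : 0 <= `[x].
Proof. exact: sqrtr_ge0. Qed.

Lemma sqr_ipnorm x : `[x] ^+ 2 = ip x x.
Proof. by rewrite sqr_sqrtr // ip_ge0. Qed.

Lemma ipnorm_eq0 x : `[x] = 0 -> x = 0.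
Proof. by move=> h; apply: (ip_eq0 hip); rewrite -sqr_ipnorm h expr0n. Qed.

Lemma ipnormZ a x : `[a *: x] = `|a| * `[x].
Proof.
by rewrite /ipnorm ipZl // ipZr mulrA -expr2 sqrtrM ?sqr_ge0 // sqrtr_sqr.
Qed.

Lemma ipnormN x : `[- x] = `[x].
Proof. by rewrite -scaleN1r ipnormZ normrN1 mul1r. Qed.

Lemma ipnorm0 : `[0] = 0.
Proof. by rewrite /ipnorm ip0l sqrtr0. Qed.

Lemma cauchy_schwarz x y : ip x y <= `[x] * `[y].
Proof.
have [x0 | x0] := eqVneq `[x] 0.
  by rewrite (ipnorm_eq0 x0) ip0l mulr_ge0 ?ipnorm_ge0.
have [y0 | y0] := eqVneq `[y] 0.
  by rewrite (ipnorm_eq0 y0) (ipC hip) ip0l mulr_ge0 ?ipnorm_ge0.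
have : 0 <= ip (`[y] *: x - `[x] *: y) (`[y] *: x - `[x] *: y) by apply: ip_ge0.
have xy0 : 0 < `[x] * `[y] by rewrite mulr_gt0 // lt_neqAle eq_sym ?x0 ?y0 ipnorm_ge0.
rewrite !(ipDl hip) !ipDr !ipNl !ipNr !(ipZl hip) !ipZr (ipC hip y x) -!sqr_ipnorm => h.
by rewrite -(ler_pM2l xy0); nra.
Qed.

Lemma cauchy_schwarz_abs x y : `|ip x y| <= `[x] * `[y].
Proof.
rewrite ler_norml cauchy_schwarz andbT lerNl -ipNl -(ipnormN x).
exact: cauchy_schwarz.
Qed.

Lemma ipnormD x y : `[x + y] <= `[x] + `[y].
Proof.
rewrite -(ler_pXn2r (_ : 0 < 2)%N) ?nnegrE ?addr_ge0 ?ipnorm_ge0 //.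
rewrite sqrrD !sqr_ipnorm !(ipDl hip) !ipDr (ipC hip y x).
have := cauchy_schwarz x y; lra.
Qed.

Lemma ipnorm_dist x y z : `[x - z] <= `[x - y] + `[y - z].
Proof. by rewrite -[x - z](subrKA y) ipnormD. Qed.

Lemma ip_closure_convex K : @convex_set R V K -> @convex_set R V (ip_closure ip K).
Proof.
move=> /convex_setP cK; apply/convex_setP => x y t Kx Ky t0 t1 eps eps0.
have [x' Kx' xx'] := Kx _ eps0; have [y' Ky' yy'] := Ky _ eps0.
exists (t *: x' + (1 - t) *: y'); first exact: cK.
have -> : t *: x' + (1 - t) *: y' - (t *: x + (1 - t) *: y) =
    t *: (x' - x) + (1 - t) *: (y' - y).
  by rewrite !scalerBr opprD addrACA.
apply: le_lt_trans (ipnormD _ _) _; rewrite !ipnormZ.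
rewrite (ger0_norm t0) ger0_norm ?subr_ge0 //.
have [-> | tn0] := eqVneq t 0; first by rewrite mul0r add0r subr0 mul1r.
have tp : 0 < t by rewrite lt_neqAle eq_sym tn0.
have : t * `[x' - x] < t * eps by rewrite ltr_pM2l.
have : (1 - t) * `[y' - y] <= (1 - t) * eps by rewrite ler_wpM2l ?subr_ge0 // ltW.
lra.
Qed.

Lemma sub_ip_closure K : K `<=` ip_closure ip K.
Proof. by move=> x Kx eps eps0; exists x; rewrite ?subrr ?ipnorm0. Qed.

Lemma ip_closureS K L : K `<=` L -> ip_closure ip K `<=` ip_closure ip L.
Proof. by move=> KL x Kx eps /Kx[w Kw ?]; exists w => //; apply: KL. Qed.

Lemma ip_closureK K : ip_closure ip (ip_closure ip K) `<=` ip_closure ip K.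
Proof.
move=> x Kx eps eps0; have e2 : 0 < eps / 2 by rewrite divr_gt0.
have [y Ky xy] := Kx _ e2; have [z Kz yz] := Ky _ e2.
exists z => //; apply: le_lt_trans (ipnorm_dist z y x) _.
by rewrite (splitr eps) ltrD.
Qed.

Lemma convexified_sub C p K : @convex_set R V K -> ip_closure ip K `<=` K ->
  normal_cone ip C p `<=` K -> convexified_normal_cone ip C p `<=` K.
Proof.
move=> cK clK NK; apply: subset_trans clK; apply: ip_closureS.
exact: conv_hull_sub.
Qed.

Lemma convexified_convex C p : @convex_set R V (convexified_normal_cone ip C p).
Proof. by apply: ip_closure_convex; apply: conv_hull_convex. Qed.

Lemma ip_cvgP (u : nat -> V) l : ip_cvg ip u l <->
  forall eps : R, 0 < eps -> exists N, forall n, (N <= n)%N -> `[u n - l] < eps.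
Proof.
split=> [/cvgrPdist_lt h eps /h[N _ NP] | h].
  by exists N => n Nn; have := NP n Nn; rewrite /= sub0r normrN ger0_norm ?ipnorm_ge0.
apply/cvgrPdist_lt => eps /h[N NP]; exists N => // n Nn /=.
by rewrite sub0r normrN ger0_norm ?ipnorm_ge0 //; apply: NP.
Qed.

End InnerProduct.

Section Isometry.
Variables (R : realType) (V W : lmodType R) (ipV : V -> V -> R) (ipW : W -> W -> R).
Hypothesis hW : inner_product ipW.
Variable phi : V -> W.
Hypotheses (phiP : forall a x y, phi (a *: x + y) = a *: phi x + phi y)
  (phi_norm : forall x, ipnorm ipW (phi x) = ipnorm ipV x).

Lemma isometryB x y : phi (x - y) = phi x - phi y.
Proof. by rewrite addrC -scaleN1r phiP scaleN1r addrC. Qed.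

(** Only regular normals at points of [C] have to be transferred: limits, convex hulls and closures
    pass through a linear isometry. *)
Lemma convexified_transfer (C : set V) (D : set W) :
  (forall p v, C p -> regular_normal_cone ipV C p v ->
     D (phi p) /\ regular_normal_cone ipW D (phi p) (phi v)) ->
  forall p v, convexified_normal_cone ipV C p v ->
    convexified_normal_cone ipW D (phi p) (phi v).
Proof.
move=> CD p; apply: (convexified_sub (K := fun v => convexified_normal_cone ipW D (phi p) (phi v))).
- apply/convex_setP => x y t Kx Ky t0 t1.
  have phiZ a z : phi (a *: z) = a *: phi z.
    have phi0 : phi 0 = 0 by have := phiP (-1) 0 0; rewrite scaler0 addr0 scaleN1r addNr.
    by rewrite -[a *: z]addr0 phiP phi0 addr0.
  rewrite phiP phiZ; have /convex_setP := @convexified_convex _ _ _ hW D (phi p); exact.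
- move=> x Kx; apply: ip_closureK => // eps /Kx[w Kw wx].
  by exists (phi w); rewrite // -isometryB phi_norm.
- move=> v [pk [vk [ck pkp vkv]]].
  apply: sub_ip_closure => //; apply: sub_conv_hull.
  exists (phi \o pk), (phi \o vk); split.
  + by move=> k; have [c1 c2] := ck k; apply: CD.
  + rewrite /ip_cvg; under eq_fun do rewrite /= -isometryB phi_norm; exact: pkp.
  + rewrite /ip_cvg; under eq_fun do rewrite /= -isometryB phi_norm; exact: vkv.
Qed.

End Isometry.

Section Graph.
Variables (R : realType) (V : lmodType R) (ip : V -> V -> R).
Hypothesis hip : inner_product ip.

Lemma ip_graph_inner_product : inner_product (ip_graph ip).
Proof.
split.
- by move=> x y; rewrite /ip_graph (ipC hip) mulrC.
- by move=> x y z; rewrite /ip_graph /= ipDl // mulrDl addrACA.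
- by move=> a x z; rewrite /ip_graph /= ipZl // mulrDr mulrA.
- by move=> x; apply: addr_ge0; [exact: ip_ge0 | rewrite -expr2 sqr_ge0].
- move=> [x t]; rewrite /ip_graph /= => /eqP.
  rewrite paddr_eq0; [|exact: ip_ge0|by rewrite -expr2 sqr_ge0].
  rewrite -expr2 sqrf_eq0 => /andP[/eqP x0 /eqP->].
  by rewrite (ip_eq0 hip x0).
Qed.

Lemma sqr_ipnorm_graph x : ipnorm (ip_graph ip) x ^+ 2 = ip x.1 x.1 + x.2 * x.2.
Proof. by rewrite sqr_ipnorm //; apply: ip_graph_inner_product. Qed.

Lemma ipnorm_graph1 x : ipnorm ip x.1 <= ipnorm (ip_graph ip) x.
Proof. by rewrite ler_wsqrtr // lerDl -expr2 sqr_ge0. Qed.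

End Graph.

Section Columns.
Variables (R : realType) (r : nat).

Lemma dotv_inner_product : inner_product (@dotv R r).
Proof.
split.
- by move=> x y; apply: eq_bigr => i _; rewrite mulrC.
- by move=> x y z; rewrite -big_split; apply: eq_bigr => i _; rewrite mxE mulrDl.
- by move=> a x z; rewrite mulr_sumr; apply: eq_bigr => i _; rewrite mxE mulrA.
- by move=> x; apply: sumr_ge0 => i _; rewrite -expr2 sqr_ge0.
- move=> x h; apply/colP => i; rewrite mxE; apply/eqP; rewrite -sqrf_eq0 expr2.
  by apply/eqP; move/psumr_eq0P: h => -> // j _; rewrite -expr2 sqr_ge0.
Qed.

Definition pcol (s : {perm 'I_r}) (u : 'cV[R]_r) : 'cV[R]_r := \col_i u (s i) 0.

Lemma pcolE s u : pcol s u = perm_mx s *m u.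
Proof. by rewrite -row_permE; apply/colP => i; rewrite !mxE. Qed.

Lemma is_perm_perm_mx (s : {perm 'I_r}) : is_perm_mx (perm_mx s : 'M[R]_r).
Proof. by apply/existsP; exists s. Qed.

Lemma symmetric_pcol f s u : symmetric_fun f -> f (pcol s u) = f u.
Proof. by move=> hf; rewrite pcolE hf // is_perm_perm_mx. Qed.

Lemma dotv_pcol s u v : dotv (pcol s u) (pcol s v) = dotv u v.
Proof.
rewrite /dotv [RHS](reindex_inj (@perm_inj _ s)).
by apply: eq_bigr => i _; rewrite !mxE.
Qed.

Lemma pcolP s a u v : pcol s (a *: u + v) = a *: pcol s u + pcol s v.
Proof. by apply/colP => i; rewrite !mxE. Qed.

Lemma pcolB s u v : pcol s (u - v) = pcol s u - pcol s v.
Proof. by apply/colP => i; rewrite !mxE. Qed.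

Lemma pcolK s : cancel (pcol s) (pcol s^-1).
Proof. by move=> u; apply/colP => i; rewrite !mxE permKV. Qed.

Lemma pcolVK s : cancel (pcol s^-1) (pcol s).
Proof. by move=> u; apply/colP => i; rewrite !mxE permK. Qed.

End Columns.

(** * Regular normals: restriction along isometries and tangent curves *)

Section RegularNormals.
Variables (R : realType) (V W : lmodType R) (ipV : V -> V -> R) (ipW : W -> W -> R).
Hypothesis hV : inner_product ipV.

Lemma regular_restrict (phi : V -> W) (C : set V) (D : set W) p v :
  (forall a x y, phi (a *: x + y) = a *: phi x + phi y) ->
  (forall x y, ipW (phi x) (phi y) = ipV x y) ->
  (forall q, C q -> D (phi q)) ->
  regular_normal_cone ipW D (phi p) (phi v) -> regular_normal_cone ipV C p v.
Proof.
move=> phiP phi_ip CD reg eps /reg[d d0 dP]; exists d => // q Cq.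
have nE : ipnorm ipV (q - p) = ipnorm ipW (phi q - phi p).
  by rewrite /ipnorm -(isometryB phiP) phi_ip.
by rewrite nE -phi_ip (isometryB phiP); apply: dP; apply: CD.
Qed.

(* The curve is followed in both directions, so [v] is orthogonal to its velocity. *)
Lemma regular_tangent (C : set V) p v x z (m : R -> R) :
  (forall k, 0 < m k <= 1) ->
  (forall k, C (p + (k * m k) *: (x + k *: z))) ->
  regular_normal_cone ipV C p v -> ipV v x = 0.
Proof.
move=> m01 Cm reg.
suff H x' (e : R) : `|e| = 1 -> x' = e *: x -> ipV v x' <= 0.
  apply/eqP; rewrite eq_le (H x 1) ?normr1 ?scale1r //=.
  have := H (- x) (-1); rewrite normrN1 scaleN1r ipNr // oppr_le0; exact.
move=> e1 x'E; rewrite leNgt; apply/negP => a0.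
set a := ipV v x' in a0; set b := ipV v z.
set nx := ipnorm ipV x'; set nz := ipnorm ipV z.
have nx0 : 0 <= nx by apply: ipnorm_ge0.
have nz0 : 0 <= nz by apply: ipnorm_ge0.
have N0 : 0 < nx + nz + 1 by lra.
have eps0 : 0 < a / (2 * (nx + nz + 1)) by rewrite divr_gt0 // mulr_gt0.
have [d d0 dP] := reg _ eps0; set eps := a / _ in eps0 dP.
have B0 : 0 < 2 * (`|b| + 1) by rewrite mulr_gt0 // ltr_pwDr.
(* If the slope [a] along [x'] is positive, this [k] makes the second-order term cost less than
   [a / 2], the choice of [eps] costs less than [a / 2] too, and the point stays within [d]. *)
pose k := Num.min 1 (Num.min (a / (2 * (`|b| + 1))) (d / (nx + nz + 1))).
have k0 : 0 < k by rewrite !lt_min ltr01 !divr_gt0.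
have k1 : k <= 1 by rewrite /k ge_min lexx.
have k2 : k * (2 * (`|b| + 1)) <= a by rewrite -ler_pdivlMr // /k !ge_min lexx orbT.
have k3 : k * (nx + nz + 1) <= d by rewrite -ler_pdivlMr // /k !ge_min lexx !orbT.
have ee : e * e = 1 by rewrite -expr2 -real_normK ?num_real // e1 expr1n.
pose mk := m (e * k); have /andP[mk0 mk1] := m01 (e * k); rewrite -/mk in mk0 mk1.
have km0 : 0 < k * mk by rewrite mulr_gt0.
have qE : p + (e * k * m (e * k)) *: (x + (e * k) *: z) - p = (k * mk) *: (x' + k *: z).
  rewrite addrC addKr x'E -/mk scalerDr scalerA scalerDr !scalerA.
  congr (_ *: _ + _ *: _); first by ring.
  by rewrite -[RHS]mulr1 -ee; ring.
have := dP _ (Cm (e * k)); rewrite qE ipnormZ // ger0_norm ?(ltW km0) //.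
have nle : ipnorm ipV (x' + k *: z) <= nx + k * nz.
  by apply: le_trans (ipnormD hV _ _) _; rewrite ipnormZ // (ger0_norm (ltW k0)).
have nle2 : ipnorm ipV (x' + k *: z) <= nx + nz.
  by apply: le_trans nle _; rewrite lerD2l ler_piMl.
have lt_d : k * mk * ipnorm ipV (x' + k *: z) < d.
  have h1 : k * mk * ipnorm ipV (x' + k *: z) <= k * (nx + nz).
    rewrite -mulrA ler_pM2l //; apply: le_trans nle2.
    by rewrite ler_piMl // ipnorm_ge0.
  by apply: le_lt_trans h1 _; lra.
move=> /(_ lt_d); rewrite ipZr // ipDr // ipZr // -/a -/b mulrCA ler_pM2l // => h.
have epsE : eps * (nx + nz + 1) = a / 2.
  by rewrite /eps invfM mulrA -mulrA mulVf ?mulr1 // gt_eqF.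
have h2 : eps * ipnorm ipV (x' + k *: z) <= eps * (nx + nz) by rewrite ler_pM2l.
have kb : - (k * `|b|) <= k * b by rewrite -mulrN ler_pM2l // lerNnormlW.
lra.
Qed.

End RegularNormals.

(** * Normal cones to spectral epigraphs *)

Section Transfer.
Variables (R : realType) (E : vectType R) (A : euclidean_jordan_algebra E).
Variables (r : nat) (hr : has_rank A r).
Variables (f : 'cV[R]_r -> \bar R) (hf : symmetric_fun f).
Local Notation "x ** y" := (jmul A x y) (at level 40, left associativity).
Local Notation e := (junit A).
Local Notation tr := (trip A r).
Local Notation lam := (eigvals A r).
Local Notation F := (spectral_fun A f).
Implicit Types (x y z c : E) (u v w : 'cV[R]_r) (a b : R) (J : 'I_r -> E).

Lemma trip_inner_product : inner_product tr.
Proof.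
split; [exact: tripC | exact: tripDl | exact: tripZl | exact: trip_ge0 | exact: trip_eq0].
Qed.

Lemma tripB x y : tr (x - y) (x - y) = tr x x + tr y y - 2 * tr x y.
Proof. by rewrite !(tripE hr) (tripC A r y x); ring. Qed.

(** For a Jordan frame, an isometric embedding of the coordinate space; [jdiag] is its adjoint. *)
Definition fsum J u : E := \sum_i u i 0 *: J i.

Lemma fsumP J a u v : fsum J (a *: u + v) = a *: fsum J u + fsum J v.
Proof.
rewrite /fsum scaler_sumr -big_split; apply: eq_bigr => i _.
by rewrite !mxE scalerDl scalerA.
Qed.

Lemma trip_fsum J u v : jordan_frame A J -> tr (fsum J u) (fsum J v) = dotv u v.
Proof. by move=> fJ; rewrite trip_frame_sum. Qed.

Lemma jdiag_fsum J u : jordan_frame A J -> jdiag A (fsum J u) J = u.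
Proof. by move=> fJ; apply/colP => i; rewrite mxE /fsum (trip_coord hr (fun i => u i 0)). Qed.

Lemma trip_fsuml J u x : tr (fsum J u) x = dotv u (jdiag A x J).
Proof.
by rewrite /fsum trip_suml //; apply: eq_bigr => i _; rewrite tripZl // mxE.
Qed.

Lemma frame_perm J (s : {perm 'I_r}) : jordan_frame A J -> jordan_frame A (J \o s).
Proof.
move=> [pJ oJ sJ]; split => [i | i j ij |]; first exact: pJ.
- by apply: oJ; rewrite (inj_eq perm_inj).
- by rewrite -sJ [RHS](reindex_inj (@perm_inj _ s)).
Qed.

Lemma fsum_perm J (s : {perm 'I_r}) u : fsum J u = fsum (J \o s) (pcol s u).
Proof.
by rewrite /fsum (reindex_inj (@perm_inj _ s)); apply: eq_bigr => i _; rewrite mxE.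
Qed.

Lemma eigvals_fsum J u : jordan_frame A J -> exists s : {perm 'I_r}, lam (fsum J u) = pcol s u.
Proof.
move=> fJ; have [s sP] := eigvals_perm hr (fun i => u i 0) fJ.
by exists s; apply/colP => i; rewrite mxE -sP.
Qed.

Lemma eigvals_fsum_sorted J u : jordan_frame A J ->
  nonincreasing_col (fun i => u i 0) -> lam (fsum J u) = u.
Proof. by move=> fJ um; apply/colP => i; rewrite /fsum (eigvalsE hr i fJ um). Qed.

Lemma spectral_fsum J u : jordan_frame A J -> F (fsum J u) = f u.
Proof.
by move=> fJ; rewrite /spectral_fun; have [s ->] := eigvals_fsum u fJ; apply: symmetric_pcol.
Qed.

Lemma joint_framesP x (s : E) J : joint_frames A x s J <->
  [/\ jordan_frame A J, x = fsum J (lam x) & s = fsum J (jdiag A s J)].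
Proof.
split=> [[fJ [a xE] [b sE] xl] | [fJ xE sE]].
  have col (c : 'I_r -> R) : \sum_i c i *: J i = fsum J (\col_i c i).
    by apply: eq_bigr => i _; rewrite mxE.
  split=> //; first by rewrite -xl xE col jdiag_fsum.
  by rewrite sE col jdiag_fsum.
split=> //.
- by exists (fun i => lam x i 0).
- by exists (fun i => jdiag A s J i 0).
- by rewrite [in LHS]xE jdiag_fsum.
Qed.

Lemma fsum_opcomm J u v : jordan_frame A J -> opcomm A (fsum J u) (fsum J v).
Proof.
move=> fJ; have JJ i j : opcomm A (J i) (J j).
  have [-> // | ij] := eqVneq i j.
  by apply: (peirce0_opcomm (frame_idem i fJ)); apply: frame_orth.
have H i : opcomm A (fsum J u) (J i).
  rewrite /fsum; elim/big_rec: _ => [y | j y _ hy]; first by rewrite !jmul0l jmul0r.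
  exact: opcommZDl.
apply: opcomm_sym; rewrite {1}/fsum; elim/big_rec: _ => [y | j y _ hy].
  by rewrite !jmul0l jmul0r.
by apply: opcommZDl hy; apply: opcomm_sym.
Qed.

Lemma joint_opcomm x (s : E) J : joint_frames A x s J -> opcomm A x s.
Proof. by move/joint_framesP=> [fJ -> ->]; apply: fsum_opcomm. Qed.

Lemma opcomm_joint x (s : E) : opcomm A x s -> exists J, joint_frames A x s J.
Proof.
move=> xs; have [J [a [b [fJ am xE sE]]]] := opcomm_frame hr xs.
exists J; split=> //; [by exists a | by exists b |].
apply/colP => i; rewrite mxE [in LHS]xE trip_coord // xE.
by rewrite (eigvalsE hr i fJ am).
Qed.

(** Testing against [y] and [z] turns commutation into a scalar identity, bilinear in [x] and [s],
    which survives limits. *)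
Lemma opcomm_trip x (s : E) : opcomm A x s <->
  forall y z, tr s (y ** (x ** z)) = tr s (z ** (x ** y)).
Proof.
have E1 y z : tr (x ** (s ** z)) y = tr s (z ** (x ** y)).
  by rewrite trip_selfadjoint // trip_assoc.
have E2 y z : tr (s ** (x ** z)) y = tr s (y ** (x ** z)).
  by rewrite trip_assoc // (jmulC A y).
split=> [xs y z | H z]; first by rewrite -E1 -E2 xs.
apply/eqP; rewrite -subr_eq0; apply/eqP/(trip_eq0 hr).
by set t := _ - _; rewrite {1}/t tripDl // tripNl // E1 E2 H subrr.
Qed.

(** Each [J i] acts as a contraction by [trip_idem], so the sum of the absolute eigenvalues of [y]
    is a bound. *)
Lemma jmul_bounded y : exists2 C : R, 0 <= C &
  forall z, ipnorm tr (y ** z) <= C * ipnorm tr z.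
Proof.
have [_ [J fJ yE]] := eigvals_frame hr y; have tip := trip_inner_product.
exists (\sum_i `|lam y i 0|); first by apply: sumr_ge0.
have Jz i z : ipnorm tr (J i ** z) <= ipnorm tr z.
  have [-> | n0] := eqVneq (ipnorm tr (J i ** z)) 0; first exact: ipnorm_ge0.
  have npos : 0 < ipnorm tr (J i ** z) by rewrite lt_neqAle eq_sym n0 ipnorm_ge0.
  rewrite -(ler_pM2l npos) -expr2 (sqr_ipnorm tip).
  apply: le_trans (cauchy_schwarz tip _ _).
  by rewrite [leRHS](trip_idem hr) ?lerDl ?mulr_ge0 ?(trip_ge0 hr) //; apply: frame_idem.
move=> z; rewrite {1}yE jmul_suml mulr_suml.
elim/big_rec2: _ => [|i b y' _ h]; first by rewrite (ipnorm0 tip).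
apply: le_trans (ipnormD tip _ _) _; apply: lerD h.
by rewrite jmulZl (ipnormZ tip) ler_wpM2l.
Qed.

Lemma bessel J z : jordan_frame A J ->
  ipnorm (@dotv R r) (jdiag A z J) <= ipnorm tr z.
Proof.
move=> fJ; apply: ler_wsqrtr; rewrite -subr_ge0.
have := trip_ge0 hr (z - fsum J (jdiag A z J)).
rewrite tripB trip_fsum // (tripC A r z (fsum _ _)) trip_fsuml; lra.
Qed.

Lemma fsum_norm J (q : 'cV[R]_r * R^o) : jordan_frame A J ->
  ipnorm (ip_graph tr) (fsum J q.1, q.2) = ipnorm (ip_graph (@dotv R r)) q.
Proof. by move=> fJ; rewrite /ipnorm /ip_graph /= trip_fsum. Qed.

(* Weighting [u] by a large [N] forces every sorting permutation of [v + N u]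
   to sort [u]; the trace inequality for [v + N u] then loses only
   [N (lam p . lam y - <p, y>) <= N / 2 |y - p|^2]. *)
Lemma regular_lift J (q w : 'cV[R]_r * R^o) : jordan_frame A J -> epi f q ->
  regular_normal_cone (ip_graph (@dotv R r)) (epi f) q w ->
  epi F (fsum J q.1, q.2) /\
  regular_normal_cone (ip_graph tr) (epi F) (fsum J q.1, q.2) (fsum J w.1, w.2).
Proof.
case: q w => u t [v b] fJ fu reg; split; first by rewrite /epi /= spectral_fsum.
(* [N] exceeds every slope of [v] against [u], so strict inequalities in [u] survive in
   [N *: u + v]. Pairs with equal entries of [u] contribute 0 by the convention on division and are
   never compared. *)
pose N := 1 + \sum_i \sum_j `|v i 0 - v j 0| / `|u i 0 - u j 0|.
have S0 : 0 <= \sum_i \sum_j `|v i 0 - v j 0| / `|u i 0 - u j 0|.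
  by apply: sumr_ge0 => i _; apply: sumr_ge0 => j _; rewrite mulr_ge0 ?invr_ge0.
have N0 : 0 < N by rewrite ltr_pwDl.
have NP i j : `|v i 0 - v j 0| / `|u i 0 - u j 0| < N.
  rewrite /N (bigD1 i) //= (bigD1 j) //=.
  have h1 : 0 <= \sum_(k | k != j) `|v i 0 - v k 0| / `|u i 0 - u k 0|.
    by apply: sumr_ge0 => k _; rewrite mulr_ge0 ?invr_ge0.
  have h2 : 0 <= \sum_(k | k != i) \sum_l `|v k 0 - v l 0| / `|u k 0 - u l 0|.
    by apply: sumr_ge0 => k _; apply: sumr_ge0 => l _; rewrite mulr_ge0 ?invr_ge0.
  by lra.
set p := fsum J u; set s := fsum J v.
have wE : fsum J (N *: u + v) = N *: p + s by rewrite fsumP.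
have [g gE] := eigvals_fsum (N *: u + v) fJ.
have [wm _] := eigvals_frame hr (fsum J (N *: u + v)).
have um : nonincreasing_col (fun i => pcol g u i 0).
  move=> i j ij; rewrite !mxE leNgt; apply/negP => ult.
  have := wm i j ij; rewrite gE !mxE => wle.
  have := NP (g i) (g j); have d0 : 0 < u (g j) 0 - u (g i) 0 by rewrite subr_gt0.
  rewrite (distrC (u (g i) 0)) (gtr0_norm d0) ltr_pdivrMr // => h.
  have := ler_norm (v (g i) 0 - v (g j) 0) => h'; lra.
have lamp : lam p = pcol g u.
  by rewrite /p (fsum_perm J g) eigvals_fsum_sorted //; apply: frame_perm.
have tip := trip_inner_product; have dip := dotv_inner_product R r.
move=> eps eps0; have e2 : 0 < eps / 2 by rewrite divr_gt0.
have [d d0 dP] := reg _ e2.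
have N1 : 0 < N + 1 by rewrite ltr_pwDr // ltW.
(* The second bound turns the quadratic error [N / 2 * n ^+ 2] into at most [eps / 2 * n]. *)
exists (Num.min d (eps / (N + 1))); first by rewrite lt_min d0 divr_gt0.
case=> y t' /= Fy; set n := ipnorm _ _; rewrite lt_min => /andP[nd].
rewrite ltr_pdivlMr // => ne.
have n0 : 0 <= n by apply: ipnorm_ge0.
(* The eigenvalues of [y] arranged in the order of [u]; by symmetry of [f] they give a test point of
   [epi f] at the same height. *)
pose u' := pcol g^-1 (lam y).
have u'E : pcol g u' = lam y by rewrite /u' pcolVK.
have fu' : epi f (u', t') by rewrite /epi /= symmetric_pcol.
have dist_u : dotv (u' - u) (u' - u) <= tr (y - p) (y - p).
  rewrite -(dotv_pcol g) pcolB u'E -lamp.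
  apply: le_trans (eigvals_lipschitz hr y p); rewrite /dotv le_eqVlt; apply/orP; left.
  by apply/eqP; apply: eq_bigr => i _; rewrite !mxE -expr2.
have np : ipnorm (ip_graph (@dotv R r)) ((u', t') - (u, t)) <= n.
  by apply: ler_wsqrtr; rewrite /ip_graph /= lerD2r.
have uu' : dotv u u' = dotv (lam p) (lam y) by rewrite -(dotv_pcol g) u'E lamp.
have trl x : tr x x = dotv (lam x) (lam x) by rewrite (trip_eigvals hr).
have lamp_p : dotv u u' - tr p y <= 2^-1 * tr (y - p) (y - p).
  have := ip_ge0 dip (lam y - lam p).
  rewrite uu' !(ipDl dip) !(ipDr dip) !(ipNl dip) !(ipNr dip) (ipC dip (lam y) (lam p)).
  by rewrite tripB (tripC A r y p) !trl => h; lra.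
have main : tr s y <= dotv v u' + N * (dotv u u' - tr p y).
  have := trip_le_eigvals hr (fsum J (N *: u + v)) y.
  rewrite wE tripDl // tripZl //.
  have -> : \sum_i lam (N *: p + s) i 0 * lam y i 0 = N * dotv u u' + dotv v u'.
    rewrite -wE gE -u'E -/(dotv _ _) dotv_pcol (ipDl dip) (ipZl dip) //.
  by move=> h; lra.
have spE : tr s p = dotv v u by rewrite trip_fsum.
have nn : tr (y - p) (y - p) <= n ^+ 2.
  by rewrite sqr_ipnorm_graph //= lerDl -expr2 sqr_ge0.
have := dP (u', t') fu' (le_lt_trans np nd); rewrite /ip_graph /= => h3.
have h4 : eps / 2 * ipnorm (ip_graph (@dotv R r)) ((u', t') - (u, t)) <= eps / 2 * n.
  by rewrite ler_pM2l.
rewrite (ipDr dip) (ipNr dip) in h3.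
rewrite /ip_graph /= tripDr // tripNr // spE.
have h5 : N * (dotv u u' - tr p y) <= N * (2^-1 * n ^+ 2).
  by rewrite ler_pM2l //; apply: le_trans lamp_p _; rewrite ler_pM2l // invr_gt0.
have h6 : N * n * n <= eps * n by rewrite ler_wpM2r //; lra.
rewrite expr2 in h5.
by move: h3 h4; rewrite /ip_graph /=; set X := ipnorm _ _ => h3 h4; lra.
Qed.

Lemma regular_restrict_frame J (q w : 'cV[R]_r * R^o) : jordan_frame A J ->
  regular_normal_cone (ip_graph tr) (epi F) (fsum J q.1, q.2) (fsum J w.1, w.2) ->
  regular_normal_cone (ip_graph (@dotv R r)) (epi f) q w.
Proof.
move=> fJ; pose phi (q : 'cV[R]_r * R^o) : E * R^o := (fsum J q.1, q.2).
apply: (regular_restrict (phi := phi)).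
- by move=> a x y; rewrite /phi /= fsumP.
- by move=> x y; rewrite /phi /ip_graph /= trip_fsum.
- by move=> x; rewrite /epi /= spectral_fsum.
Qed.

Lemma regular_perm (s : {perm 'I_r}) (q w : 'cV[R]_r * R^o) :
  regular_normal_cone (ip_graph (@dotv R r)) (epi f) q w ->
  regular_normal_cone (ip_graph (@dotv R r)) (epi f) (pcol s q.1, q.2) (pcol s w.1, w.2).
Proof.
pose phi (q : 'cV[R]_r * R^o) : 'cV[R]_r * R^o := (pcol s^-1 q.1, q.2).
have phiE o : phi (pcol s o.1, o.2) = o by case: o => o1 o2; rewrite /phi /= pcolK.
rewrite -{1}(phiE q) -{1}(phiE w); apply: regular_restrict.
- by move=> a x y; rewrite /phi /= pcolP.
- by move=> x y; rewrite /phi /ip_graph /= dotv_pcol.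
- by move=> x; rewrite /epi /= symmetric_pcol.
Qed.

Lemma idem_trace_ge1 c : jidempotent A c -> c != 0 -> 1 <= tr c e.
Proof.
move=> hc c0; have [q [q1 _ trE]] := trip_vector hr.
have [[|d l] [pl _ sl]] := primitive_decomposition hc.
  by rewrite -sl big_nil eqxx in c0.
rewrite trE jmul1r -sl big_cons linearDr /= q1; last exact/pl/mem_head.
rewrite lerDl linear_sumr big_seq sumr_ge0 // => x xl.
by rewrite /= q1 //; apply: pl; rewrite inE xl orbT.
Qed.

(** Nonzero idempotents have trace at least 1, so trace 1 leaves no room for two. This certifies the
    rotated idempotents. *)
Lemma primitive_trace1 c : jidempotent A c -> tr c e = 1 -> jprimitive A c.
Proof.
move=> hc c1; split => //.
  by apply/eqP => c0; have := c1; rewrite c0 trip0l // => /esym/eqP; rewrite oner_eq0.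
move=> [d1 [d2 [[h1 h2 n1 n2] [_ cE]]]].
have := lerD (idem_trace_ge1 h1 n1) (idem_trace_ge1 h2 n2).
by rewrite -tripDl // -cE c1 gerDl ler10.
Qed.

(** * Rotating two members of a Jordan frame *)

Section Rotation.
Variables (J : 'I_r -> E) (i j : 'I_r) (u : E).
Hypotheses (fJ : jordan_frame A J) (ij : i != j)
  (iu : J i ** u = 2^-1 *: u) (ju : J j ** u = 2^-1 *: u).
Let th := 2^-1 * tr u u.
Let m (k : R) := (1 + k ^+ 2 * th)^-1.

Lemma pair_idem : jidempotent A (J i + J j).
Proof.
have oij := frame_orth fJ ij; have oji : J j ** J i = 0 by rewrite jmulC.
by rewrite /jidempotent !jmulE oij oji !frame_idem // addr0 add0r.
Qed.

Lemma pair_half : (J i + J j) ** u = u.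
Proof.
by rewrite jmulDl iu ju -scalerDl -[RHS]scale1r; congr (_ *: _); field.
Qed.

(** By [peirce_hh] and primitivity, multiplying [u ** u] by [J i] or [J j] gives a multiple of that
    idempotent; the trace determines the factor [th]. *)
Lemma half_half_sq : u ** u = th *: (J i + J j).
Proof.
have Jsq l : J l ** u = 2^-1 *: u -> J l ** (u ** u) = th *: J l.
  move=> lu; have hl := frame_idem l fJ.
  have [a aE] : exists a, J l ** (u ** u) = a *: J l.
    apply: primitive_peirce1; last exact: peirce_hh.
    by case: fJ.
  rewrite aE; congr (_ *: _); have := congr1 (tr (J l)) aE.
  rewrite -trip_assoc // hl tripZr // trip_frame // eqxx mulr1 => <-.
  by rewrite -trip_assoc // lu tripZl.
have hq := pair_idem.
by rewrite -(peirce11 hq pair_half pair_half) jmulDl !Jsq // scalerDr.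
Qed.

Lemma half_half_orth l : l != i -> l != j -> J l ** u = 0.
Proof.
move=> li lj.
have hq := pair_idem.
rewrite jmulC; apply: (peirce10 hq pair_half).
by rewrite jmulDl !frame_orth 1?eq_sym // addr0.
Qed.

Let v3 (x1 x2 x3 : R) : E := x1 *: J i + x2 *: J j + x3 *: u.

Lemma span3D (x1 x2 x3 y1 y2 y3 : R) :
  v3 x1 x2 x3 + v3 y1 y2 y3 = v3 (x1 + y1) (x2 + y2) (x3 + y3).
Proof. by rewrite /v3 !scalerDl addrACA (addrACA (x1 *: _)). Qed.

Lemma span3Z (c x1 x2 x3 : R) : c *: v3 x1 x2 x3 = v3 (c * x1) (c * x2) (c * x3).
Proof. by rewrite /v3 !scalerDr !scalerA. Qed.

Lemma span3_mul (x1 x2 x3 y1 y2 y3 : R) : v3 x1 x2 x3 ** v3 y1 y2 y3 =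
  v3 (x1 * y1 + x3 * y3 * th) (x2 * y2 + x3 * y3 * th)
     (2^-1 * ((x1 + x2) * y3 + x3 * (y1 + y2))).
Proof.
have oij := frame_orth fJ ij; have oji : J j ** J i = 0 by rewrite jmulC.
have ui : u ** J i = 2^-1 *: u by rewrite jmulC.
have uj : u ** J j = 2^-1 *: u by rewrite jmulC.
have iv : J i ** v3 y1 y2 y3 = v3 y1 0 (2^-1 * y3).
  rewrite /v3 !jmulDr !jmulZr frame_idem // oij iu scaler0 scale0r scalerA.
  by rewrite (mulrC y3).
have jv : J j ** v3 y1 y2 y3 = v3 0 y2 (2^-1 * y3).
  rewrite /v3 !jmulDr !jmulZr frame_idem // oji ju scaler0 scale0r scalerA.
  by rewrite (mulrC y3).
have uv : u ** v3 y1 y2 y3 = v3 (y3 * th) (y3 * th) (2^-1 * (y1 + y2)).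
  rewrite /v3 !jmulDr !jmulZr ui uj half_half_sq !scalerA -scalerDl addrC scalerDr.
  by rewrite -mulrDl (mulrC (y1 + y2)).
rewrite {1}/v3 !jmulDl !jmulZl iv jv uv !span3Z !span3D; move: (th) => h.
by congr (v3 _ _ _); ring.
Qed.

(* [J i], [J j] and [u] span a copy of the symmetric 2 x 2 matrices, in which
   the frame [J i], [J j] is rotated with a rational parametrization. *)
Definition rotation k l : E :=
  if l == i then v3 (m k) (m k * (k ^+ 2 * th)) (m k * k)
  else if l == j then v3 (m k * (k ^+ 2 * th)) (m k) (- (m k * k))
  else J l.

Lemma rotation_den k : 0 < 1 + k ^+ 2 * th.
Proof. by rewrite ltr_pwDl // mulr_ge0 ?sqr_ge0 // mulr_ge0 ?trip_ge0 // invr_ge0. Qed.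

(** The displacement is put in the shape required by [regular_tangent], with velocity
    [(a i - a j) *: u]. *)
Lemma rotation_sum k (a : 'I_r -> R) :
  \sum_l a l *: rotation k l = \sum_l a l *: J l +
   (k * m k) *: ((a i - a j) *: u + k *: (((a i - a j) * th) *: (J j - J i))).
Proof.
have ji : j != i by rewrite eq_sym.
rewrite (bigD1 i) //= (bigD1 j) //= [in RHS](bigD1 i) //= [in RHS](bigD1 j) //=.
have -> : \sum_(l | (l != i) && (l != j)) a l *: rotation k l =
    \sum_(l | (l != i) && (l != j)) a l *: J l.
  by apply: eq_bigr => l /andP[li lj]; rewrite /rotation (negPf li) (negPf lj).
rewrite /rotation eqxx (negPf ji) eqxx; move: (\sum_(l | _) _) => rest.
have iE (c : R) : c *: J i = v3 c 0 0 by rewrite /v3 !scale0r !addr0.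
have jE (c : R) : c *: J j = v3 0 c 0 by rewrite /v3 !scale0r add0r addr0.
have -> : (k * m k) *: ((a i - a j) *: u + k *: (((a i - a j) * th) *: (J j - J i))) =
    v3 (- (k * m k * k * ((a i - a j) * th))) (k * m k * k * ((a i - a j) * th))
       (k * m k * (a i - a j)).
  by rewrite /v3 !scalerDr !scalerN !scalerA scaleNr [in LHS]addrC (addrC (- _)).
have AC (y1 y2 y3 y4 : E) : y1 + (y2 + y3) + y4 = y1 + y2 + y4 + y3.
  by rewrite addrA [LHS]addrAC.
rewrite iE jE !span3Z [LHS]addrA [RHS]AC !span3D; congr (_ + _).
have : 1 + k ^+ 2 * th != 0 by rewrite gt_eqF // rotation_den.
by rewrite /m; move: (th) => h hn0; congr (v3 _ _ _); field.
Qed.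

Lemma rotation_frame k : jordan_frame A (rotation k).
Proof.
have d0 := rotation_den k; have dn0 : 1 + k ^+ 2 * th != 0 by rewrite gt_eqF.
have ji : j != i by rewrite eq_sym.
have tu0 : tr u e = 0.
  have half0 l : J l ** J l = J l -> J l ** u = 2^-1 *: u -> tr (J l) u = 0.
    move=> ll lu; have := trip_assoc hr (J l) (J l) u.
    by rewrite ll lu tripZr // => h; lra.
  by rewrite -pair_half trip_assoc // jmul1r tripDl // !half0 ?frame_idem // addr0.
have [pJ oJ sJ] := fJ.
have ki : rotation k i = v3 (m k) (m k * (k ^+ 2 * th)) (m k * k).
  by rewrite /rotation eqxx.
have kj : rotation k j = v3 (m k * (k ^+ 2 * th)) (m k) (- (m k * k)).
  by rewrite /rotation eqxx (negPf ji).
have kl l : l != i -> l != j -> rotation k l = J l.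
  by move=> li lj; rewrite /rotation (negPf li) (negPf lj).
have hi : jidempotent A (rotation k i).
  rewrite /jidempotent ki span3_mul /m; move: (th) dn0 => h hn0.
  by congr (v3 _ _ _); field.
have hj : jidempotent A (rotation k j).
  rewrite /jidempotent kj span3_mul /m; move: (th) dn0 => h hn0.
  by congr (v3 _ _ _); field.
have hij : rotation k i ** rotation k j = 0.
  rewrite ki kj span3_mul; move: (th) (m k) => h m0.
  rewrite (_ : 2^-1 * _ = 0); last by field.
  rewrite (_ : _ + _ = 0); last by ring.
  by rewrite (_ : _ + _ = 0); [rewrite /v3 !scale0r !addr0 | ring].
have v3l (x1 x2 x3 : R) l : l != i -> l != j -> v3 x1 x2 x3 ** J l = 0.
  move=> li lj; rewrite /v3 !jmulDl !jmulZl ![_ ** J l]jmulC half_half_orth //.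
  by rewrite (frame_orth fJ li) (frame_orth fJ lj) !scaler0 !addr0.
have hil l : l != i -> l != j -> rotation k i ** J l = 0 by rewrite ki; apply: v3l.
have hjl l : l != i -> l != j -> rotation k j ** J l = 0 by rewrite kj; apply: v3l.
have tJ l := trip_unit hr l fJ.
split.
- move=> l; have [-> | li] := eqVneq l i.
    apply: primitive_trace1 => //; rewrite ki /v3 !tripDl // !tripZl // !tJ tu0.
    by rewrite /m; move: (th) dn0 => h hn0; field.
  have [-> | lj] := eqVneq l j.
    apply: primitive_trace1 => //; rewrite kj /v3 !tripDl // !tripZl // !tJ tu0.
    by rewrite /m; move: (th) dn0 => h hn0; field.
  by rewrite kl.
- move=> l l'; have [-> | li] := eqVneq l i; have [-> | l'i] := eqVneq l' i.
  + by [].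
  + by have [-> // | l'j] := eqVneq l' j; rewrite (kl l') // hil.
  + by rewrite jmulC; have [-> // | lj] := eqVneq l j; rewrite (kl l) // hil.
  + have [-> | lj] := eqVneq l j; have [-> | l'j] := eqVneq l' j.
    * by [].
    * by rewrite (kl l') // hjl.
    * by rewrite jmulC (kl l) // hjl.
    * by rewrite !kl //; apply: oJ.
(* Equal coefficients make the displacement vanish, so the sum of the frame is unchanged. *)
- have := rotation_sum k (fun=> 1); rewrite subrr mul0r !scale0r scaler0 addr0 scaler0 addr0.
  by under eq_bigr do rewrite scale1r; under [in RHS]eq_bigr do rewrite scale1r; move=> ->.
Qed.

End Rotation.

(** [s] need not be diagonal in [J] inside an eigenspace of [x], so [J] is grouped by eigenvalue
    into the [w a] and each block is diagonalized anew. *)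
Lemma eigenspace_split x (s : E) J : jordan_frame A J -> x = fsum J (lam x) ->
  (forall i j, lam x i 0 != lam x j 0 -> J i ** (J j ** s) = 0) -> opcomm A x s.
Proof.
move=> fJ xE Js; have [_ _ sJ] := fJ.
pose vals := undup [seq lam x i 0 | i <- enum 'I_r].
pose w (a : R) := \sum_(i | lam x i 0 == a) J i.
have uv : uniq vals by apply: undup_uniq.
have group (G : 'I_r -> E) :
    \sum_(a <- vals) \sum_(i | lam x i 0 == a) G i = \sum_i G i.
  rewrite (exchange_big_dep predT) //=; apply: eq_bigr => i _.
  rewrite big_mkcond (bigD1_seq (lam x i 0)) //=; last first.
    by rewrite mem_undup; apply: map_f; rewrite mem_enum.
  rewrite eqxx big1 ?addr0 // => a; rewrite eq_sym; exact: ifN.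
have ww : {in vals &, forall a b, a != b -> w a ** w b = 0}.
  move=> a b _ _ ab; rewrite /w jmul_suml big1 // => i /eqP ia.
  rewrite jmul_sumr big1 // => j /eqP jb; apply: frame_orth fJ _.
  by apply: contra_neq ab => ij; rewrite -ia -jb ij.
have hw a : a \in vals -> jidempotent A (w a).
  move=> _; rewrite /jidempotent /w jmul_suml; apply: eq_bigr => i ia.
  rewrite jmul_sumr (bigD1 i) //= frame_idem // big1 ?addr0 // => j /andP[_ ji].
  by apply: frame_orth; rewrite // eq_sym.
have sw : \sum_(a <- vals) w a = e by rewrite group.
have wws : {in vals &, forall a b, a != b -> w a ** (w b ** s) = 0}.
  move=> a b _ _ ab; rewrite /w jmul_suml big1 // => i /eqP ia.
  rewrite jmul_suml jmul_sumr big1 // => j /eqP jb.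
  by apply: Js; rewrite ia jb.
have [J' [a [b [fJ' am xE' sE']]]] := split_frame hr uv ww hw sw wws.
have xE2 : \sum_(a <- vals) a *: w a = x.
  rewrite xE /fsum -group; apply: eq_bigr => a0 _; rewrite scaler_sumr.
  by apply: eq_bigr => i /eqP ->.
have col (c : 'I_r -> R) : \sum_i c i *: J' i = fsum J' (\col_i c i).
  by apply: eq_bigr => i _; rewrite mxE.
by rewrite -xE2 xE' sE' !col; apply: fsum_opcomm.
Qed.

(** Let [u] be the component of the normal coupling [J i] and [J j], for distinct eigenvalues.
    Rotating the frame towards [u] keeps the eigenvalues, so the normal is orthogonal to [u]; but
    [tr u u] is a quarter of their inner product. *)
Lemma regular_opcomm (q w : E * R^o) : epi F q ->
  regular_normal_cone (ip_graph tr) (epi F) q w -> opcomm A q.1 w.1.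
Proof.
case: q w => p t [s b] /= Fp reg; have [pm [J fJ pE]] := eigvals_frame hr p.
apply: (eigenspace_split fJ pE) => i j lij.
have ij : i != j by apply: contra_neq lij => ->.
have oij := frame_orth fJ ij.
have oji : J j ** J i = 0 by rewrite jmulC.
set u := J i ** (J j ** s).
have uE : u = J j ** (J i ** s) by rewrite /u (peirce0_opcomm (frame_idem i fJ) oij).
have iu : J i ** u = 2^-1 *: u by apply: peirce_half_orth oij; apply: frame_idem.
have ju : J j ** u = 2^-1 *: u.
  by rewrite uE; apply: peirce_half_orth oji; apply: frame_idem.
pose th := 2^-1 * tr u u; pose l := lam p i 0 - lam p j 0.
pose X : E * R^o := (l *: u, 0); pose Z : E * R^o := ((l * th) *: (J j - J i), 0).
have tan : ip_graph tr (s, b) X = 0.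
  apply: (@regular_tangent _ _ _ (ip_graph_inner_product trip_inner_product)
    (epi F) (p, t) (s, b) X Z (fun k => (1 + k ^+ 2 * th)^-1)) => //.
    move=> k; have d0 : 0 < 1 + k ^+ 2 * th := rotation_den u k.
    rewrite invr_gt0 d0 invf_le1 // lerDl mulr_ge0 ?sqr_ge0 // mulr_ge0 ?invr_ge0 //.
    exact: trip_ge0.
  move=> k; rewrite /epi /= scaler0 addr0 scaler0 addr0.
  have fJk := rotation_frame fJ ij iu ju k.
  rewrite {1}pE -(rotation_sum J u ij k (fun i => lam p i 0)).
  by rewrite -/(fsum _ _) spectral_fsum.
apply: (trip_eq0 hr); rewrite {1}/u trip_selfadjoint // iu tripZr //.
rewrite trip_selfadjoint // ju tripZr //.
move: tan; rewrite /ip_graph /= mulr0 addr0 tripZr // => /eqP.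
by rewrite mulf_eq0 subr_eq0 (negPf lij) /= => /eqP ->; rewrite !mulr0.
Qed.


(** * Limiting normals *)

(** The defect of commutation [g] is bilinear and bounded by [C] times both norms, so it varies
    continuously. *)
Lemma opcomm_limit x (s : E) :
  (forall eps : R, 0 < eps -> exists x' s', [/\ opcomm A x' s',
     ipnorm tr (x' - x) < eps & ipnorm tr (s' - s) < eps]) ->
  opcomm A x s.
Proof.
move=> H; apply/opcomm_trip => y z; have tip := trip_inner_product.
pose g x' s' := tr s' (y ** (x' ** z)) - tr s' (z ** (x' ** y)).
have gD x1 x2 s' : g (x1 + x2) s' = g x1 s' + g x2 s'.
  by rewrite /g !jmulDl !jmulDr !(tripE hr); ring.
have gDr x' s1 s2 : g x' (s1 + s2) = g x' s1 + g x' s2.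
  by rewrite /g !tripDl //; ring.
have [Cy Cy0 CyP] := jmul_bounded y; have [Cz Cz0 CzP] := jmul_bounded z.
pose C := 2 * (Cy * Cz).
have C0 : 0 <= C by rewrite !mulr_ge0.
have gb x' s' : `|g x' s'| <= C * (ipnorm tr x' * ipnorm tr s').
  have gE : g x' s' = tr (y ** s') (z ** x') - tr (z ** s') (y ** x').
    by rewrite /g !trip_selfadjoint // (jmulC A x' z) (jmulC A x' y).
  have h1 := cauchy_schwarz_abs tip (y ** s') (z ** x').
  have h2 := cauchy_schwarz_abs tip (z ** s') (y ** x').
  have h3 : ipnorm tr (y ** s') * ipnorm tr (z ** x') <=
      (Cy * ipnorm tr s') * (Cz * ipnorm tr x').
    by apply: ler_pM; rewrite ?ipnorm_ge0.
  have h4 : ipnorm tr (z ** s') * ipnorm tr (y ** x') <=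
      (Cz * ipnorm tr s') * (Cy * ipnorm tr x').
    by apply: ler_pM; rewrite ?ipnorm_ge0.
  rewrite gE; apply: le_trans (ler_normB _ _) _; rewrite /C; lra.
suff : g x s = 0 by move=> /eqP; rewrite subr_eq0 => /eqP.
apply/eqP; rewrite -normr_le0; apply/ler_addgt0Pr => eps eps0; rewrite add0r.
set a := ipnorm tr x; set b := ipnorm tr s.
have a0 : 0 <= a by apply: ipnorm_ge0.
have b0 : 0 <= b by apply: ipnorm_ge0.
have D0 : 0 < C * (a + b + 1) + 1 by rewrite ltr_pwDr // mulr_ge0 // !addr_ge0.
pose eta := Num.min 1 (eps / (C * (a + b + 1) + 1)).
have eta0 : 0 < eta by rewrite lt_min ltr01 divr_gt0.
have eta1 : eta <= 1 by rewrite ge_min lexx.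
have eta2 : eta * (C * (a + b + 1) + 1) <= eps.
  by rewrite -ler_pdivlMr // /eta ge_min lexx orbT.
have [x' [s' [xs' xx' ss']]] := H _ eta0.
have gxs' : g x' s' = 0 by rewrite /g (opcomm_trip x' s').1 // subrr.
have gE : g x s = - g x (s' - s) - g (x' - x) s'.
  have h1 : g x s' = g x s + g x (s' - s) by rewrite -gDr addrC subrK.
  have h2 : g x' s' = g x s' + g (x' - x) s' by rewrite -gD addrC subrK.
  by move: h2; rewrite gxs' h1 => h2; lra.
have s'b : ipnorm tr s' <= b + eta.
  have -> : s' = s + (s' - s) by rewrite addrC subrK.
  by apply: le_trans (ipnormD tip _ _) _; rewrite lerD2l ltW.
rewrite gE; apply: le_trans (ler_normB _ _) _; rewrite normrN.
have h1 := gb x (s' - s); have h2 := gb (x' - x) s'.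
have h3 : C * (a * ipnorm tr (s' - s)) <= C * (a * eta).
  by rewrite ler_wpM2l // ler_wpM2l // ltW.
have h4 : C * (ipnorm tr (x' - x) * ipnorm tr s') <= C * (eta * (b + 1)).
  rewrite ler_wpM2l // ler_pM ?ipnorm_ge0 ?(ltW xx') //.
  by apply: le_trans s'b _; rewrite lerD2l.
have h5 : 0 <= eta by apply: ltW.
rewrite -/a in h1; lra.
Qed.

Lemma ip_graph_close (V : lmodType R) (ip : V -> V -> R) (o o' : V * R^o) (eps : R) :
  ipnorm (ip_graph ip) (o - o') < eps -> ipnorm ip (o.1 - o'.1) < eps.
Proof. exact: le_lt_trans (ipnorm_graph1 ip (o - o')). Qed.

(** A single permutation must serve base points and normals, since [regular_perm] moves both;
    [joint_matching] adds the two costs for that reason. *)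
Lemma joint_step x (s : E) J (p t : E) (q w : 'cV[R]_r) (a b c d : R^o) J' :
  joint_frames A x s J -> joint_frames A p t J' ->
  exists g : {perm 'I_r},
    let n := ipnorm (ip_graph tr) ((p, a) - (x, b)) + ipnorm (ip_graph tr) ((t, c) - (s, d)) in
    ipnorm (ip_graph (@dotv R r)) ((pcol g (lam p), a) - (lam x, b)) <= n /\
    ipnorm (ip_graph (@dotv R r)) ((pcol g (jdiag A t J'), c) - (jdiag A s J, d)) <= n.
Proof.
move=> /joint_framesP[fJ xE sE] /joint_framesP[fJ' pE tE].
have tip := trip_inner_product; have gip := ip_graph_inner_product tip.
have dip := ip_graph_inner_product (dotv_inner_product R r).
have [g gP] := joint_matching hr (fun i => lam x i 0) (fun i => jdiag A s J i 0)
  (fun i => lam p i 0) (fun i => jdiag A t J' i 0) fJ fJ'.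
rewrite /= -!/(fsum _ _) -xE -pE -sE -tE in gP; exists g => n.
pose n1 := ipnorm (ip_graph tr) ((p, a) - (x, b)).
pose n2 := ipnorm (ip_graph tr) ((t, c) - (s, d)).
have nE : n = n1 + n2 by [].
have n10 : 0 <= n1 by apply: ipnorm_ge0.
have n20 : 0 <= n2 by apply: ipnorm_ge0.
have n0 : 0 <= n by rewrite nE addr_ge0.
have S1 : 0 <= \sum_i (lam x i 0 - lam p (g i) 0) ^+ 2 by apply: sumr_ge0 => i _; apply: sqr_ge0.
have S2 : 0 <= \sum_i (jdiag A s J i 0 - jdiag A t J' (g i) 0) ^+ 2.
  by apply: sumr_ge0 => i _; apply: sqr_ge0.
have e1 : n1 ^+ 2 = tr (x - p) (x - p) + (a - b) ^+ 2.
  by rewrite sqr_ipnorm_graph //= -opprB tripNl // tripNr // opprK expr2.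
have e2 : n2 ^+ 2 = tr (s - t) (s - t) + (c - d) ^+ 2.
  by rewrite sqr_ipnorm_graph //= -opprB tripNl // tripNr // opprK expr2.
have n1n2 : 0 <= n1 * n2 by apply: mulr_ge0.
split; rewrite -(ler_pXn2r (_ : 0 < 2)%N) ?nnegrE ?ipnorm_ge0 //.
- rewrite sqr_ipnorm_graph //=; last exact: dotv_inner_product.
  have -> : dotv (pcol g (lam p) - lam x) (pcol g (lam p) - lam x) =
      \sum_i (lam x i 0 - lam p (g i) 0) ^+ 2.
    by apply: eq_bigr => i _; rewrite !mxE; ring.
  by have := sqr_ge0 (c - d); rewrite nE [(n1 + n2) ^+ 2]sqrrD e1 e2 -expr2; lra.
- rewrite sqr_ipnorm_graph //=; last exact: dotv_inner_product.
  have -> : dotv (pcol g (jdiag A t J') - jdiag A s J) (pcol g (jdiag A t J') - jdiag A s J) =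
      \sum_i (jdiag A s J i 0 - jdiag A t J' (g i) 0) ^+ 2.
    by apply: eq_bigr => i _; rewrite !mxE; ring.
  by have := sqr_ge0 (a - b); rewrite nE [(n1 + n2) ^+ 2]sqrrD e1 e2 -expr2; lra.
Qed.

(** The frame [J] of the limit is fixed; the coordinates of each approximating pair, taken in its
    own frame, are permuted to approach those in [J]. *)
Lemma normal_cone_joint x (s : E) (t b : R^o) :
  normal_cone (ip_graph tr) (epi F) (x, t) (s, b) ->
  exists2 J, joint_frames A x s J &
    normal_cone (ip_graph (@dotv R r)) (epi f) (lam x, t) (jdiag A s J, b).
Proof.
have tip := trip_inner_product; have gip := ip_graph_inner_product tip.
have dip := ip_graph_inner_product (dotv_inner_product R r).
move=> [pk [vk [ck /ip_cvgP pkp /ip_cvgP vkv]]].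
have ock k : opcomm A (pk k).1 (vk k).1 by case: (ck k) => c1 c2; apply: regular_opcomm c2.
have both eps : 0 < eps -> exists N, forall n, (N <= n)%N ->
    ipnorm (ip_graph tr) (pk n - (x, t)) < eps /\ ipnorm (ip_graph tr) (vk n - (s, b)) < eps.
  move=> eps0; have [N1 h1] := pkp _ eps0; have [N2 h2] := vkv _ eps0.
  exists (maxn N1 N2) => n; rewrite geq_max => /andP[n1 n2].
  by split; [apply: h1 | apply: h2].
have xs : opcomm A x s.
  apply: opcomm_limit => eps /both[N /(_ N (leqnn N))[h1 h2]].
  exists (pk N).1, (vk N).1; split=> //.
  - exact: (ip_graph_close h1).
  - exact: (ip_graph_close h2).
have [J jJ] := opcomm_joint xs; exists J => //.
have /choice[g gP] : forall k, exists o : ('cV[R]_r * R^o) * ('cV[R]_r * R^o),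
    let n := ipnorm (ip_graph tr) (pk k - (x, t)) + ipnorm (ip_graph tr) (vk k - (s, b)) in
    [/\ epi f o.1, regular_normal_cone (ip_graph (@dotv R r)) (epi f) o.1 o.2,
      ipnorm (ip_graph (@dotv R r)) (o.1 - (lam x, t)) <= n &
      ipnorm (ip_graph (@dotv R r)) (o.2 - (jdiag A s J, b)) <= n].
  move=> k; have [J' jJ'] := opcomm_joint (ock k); have [c1 c2] := ck k.
  case: (pk k) (vk k) c1 c2 jJ' => p a [v c] /= Fp reg jJ'.
  have [g [g1 g2]] := joint_step (lam x) (lam x) a t c b jJ jJ'.
  exists ((pcol g (lam p), a), (pcol g (jdiag A v J'), c)); split => //=.
    by rewrite /epi /= symmetric_pcol.
  have /joint_framesP[fJ' pE vE] := jJ'.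
  apply: (regular_perm g (q := (lam p, a)) (w := (jdiag A v J', c))).
  by apply: (regular_restrict_frame fJ'); rewrite /= -pE -vE.
exists (fun k => (g k).1), (fun k => (g k).2); split.
- by move=> k; have [] := gP k.
- apply/ip_cvgP => eps eps0; have e2 : 0 < eps / 2 by rewrite divr_gt0.
  have [N NP] := both _ e2; exists N => n /NP[h1 h2]; have [_ _ + _] := gP n.
  by move=> /le_lt_trans; apply; rewrite (splitr eps) ltrD.
- apply/ip_cvgP => eps eps0; have e2 : 0 < eps / 2 by rewrite divr_gt0.
  have [N NP] := both _ e2; exists N => n /NP[h1 h2]; have [_ _ _ +] := gP n.
  by move=> /le_lt_trans; apply; rewrite (splitr eps) ltrD.
Qed.

(* The Gram matrix of two frames diagonalizing [x] only couples equal
   eigenvalues, so Birkhoff's theorem uses permutations fixing [lam x]. *)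
Lemma convex_jdiag x (s : E) J J' (K : set 'cV[R]_r) :
  @convex_set R 'cV[R]_r K ->
  (forall g, pcol g (lam x) = lam x -> forall v, K v -> K (pcol g v)) ->
  joint_frames A x s J -> jordan_frame A J' -> x = fsum J' (lam x) ->
  K (jdiag A s J) -> K (jdiag A s J').
Proof.
move=> /convex_setP cK Kg /joint_framesP[fJ xE sE] fJ' xE' Ks.
have DS := frame_gram_doubly_stochastic hr fJ' fJ.
have -> : jdiag A s J' = frame_gram A J' J *m jdiag A s J.
  apply/colP => i; rewrite !mxE [in LHS]sE /fsum trip_sumr //.
  by apply: eq_bigr => j _; rewrite tripZr // !mxE mulrC.
apply: (birkhoff (K := fun M => K (M *m jdiag A s J)) _ DS).
  by move=> M N t KM KN t0 t1; rewrite mulmxDl -!scalemxAl; apply: cK.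
move=> g gP; rewrite -pcolE; apply: Kg => //; apply/colP => i; rewrite mxE.
have xJ (J0 : 'I_r -> E) (fJ0 : jordan_frame A J0) k : x = fsum J0 (lam x) ->
    x ** J0 k = lam x k 0 *: J0 k.
  move=> xk; rewrite {1}xk /fsum jmul_suml (bigD1 k) //= jmulZl frame_idem //.
  by rewrite big1 ?addr0 // => l lk; rewrite jmulZl frame_orth ?scaler0.
have := trip_selfadjoint hr x (J' i) (J (g i)); rewrite (xJ _ fJ' i xE') (xJ _ fJ (g i) xE).
rewrite tripZl // tripZr // => h.
have := gP i; rewrite mxE => /gt_eqF/negbT D0.
by apply/esym/(mulIf D0).
Qed.

Lemma opcommZD x (s1 s2 : E) a b : opcomm A x s1 -> opcomm A x s2 ->
  opcomm A x (a *: s1 + b *: s2).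
Proof. by move=> h1 h2 y; rewrite !jmulE h1 h2. Qed.

Lemma jdiagD (s1 s2 : E) a b J :
  jdiag A (a *: s1 + b *: s2) J = a *: jdiag A s1 J + b *: jdiag A s2 J.
Proof. by apply/colP => i; rewrite !mxE tripDr // !tripZr. Qed.

Lemma joint_conv_hull x (B : set 'cV[R]_r) :
  (forall g, pcol g (lam x) = lam x -> forall v, B v -> B (pcol g v)) ->
  conv_hull [set s : E | exists2 J, joint_frames A x s J & B (jdiag A s J)] =
  [set s : E | exists2 J, joint_frames A x s J & conv_hull B (jdiag A s J)].
Proof.
move=> Bg; have cB : @convex_set R 'cV[R]_r (conv_hull B) by apply: conv_hull_convex.
have Kg g : pcol g (lam x) = lam x -> forall v, conv_hull B v -> conv_hull B (pcol g v).
  move=> gx; apply: (conv_hull_sub (K := fun v => conv_hull B (pcol g v))).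
    apply/convex_setP => v w t Kv Kw t0 t1; rewrite pcolP.
    have -> : pcol g ((1 - t) *: w) = (1 - t) *: pcol g w.
      by apply/colP => i; rewrite !mxE.
    by move/convex_setP: cB; apply.
  by move=> v Bv; apply: sub_conv_hull; apply: Bg.
apply/seteqP; split.
  apply: conv_hull_sub; last first.
    by move=> s [J jJ Bs]; exists J => //; apply: sub_conv_hull.
  apply/convex_setP => s1 s2 t [J1 j1 B1] [J2 j2 B2] t0 t1.
  (* [J] need not diagonalize [s1] or [s2]: [convex_jdiag] only asks that it diagonalize [x] in
     sorted order, and [jdiag] is linear. *)
  have [J jJ] := opcomm_joint (opcommZD t (1 - t) (joint_opcomm j1) (joint_opcomm j2)).
  have [fJ xE _] := (joint_framesP _ _ _).1 jJ.
  exists J => //; rewrite jdiagD; move/convex_setP: (cB); apply=> //.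
  - exact: convex_jdiag j1 fJ xE B1.
  - exact: convex_jdiag j2 fJ xE B2.
move=> s [J jJ]; have [fJ xE sE] := (joint_framesP _ _ _).1 jJ; rewrite sE.
rewrite jdiag_fsum //.
pose K := conv_hull [set s : E | exists2 J, joint_frames A x s J & B (jdiag A s J)].
apply: (conv_hull_sub (K := fun v => K (fsum J v))).
  apply/convex_setP => v w t Kv Kw t0 t1; rewrite fsumP.
  have -> : fsum J ((1 - t) *: w) = (1 - t) *: fsum J w.
    by rewrite /fsum scaler_sumr; apply: eq_bigr => i _; rewrite mxE scalerA.
  have /convex_setP : @convex_set R E K by apply: conv_hull_convex.
  exact.
move=> v Bv; apply: sub_conv_hull; exists J; last by rewrite jdiag_fsum.
by apply/joint_framesP; rewrite jdiag_fsum.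
Qed.

(** * Convexified normal cones and the Clarke subdifferential *)

Local Notation NF x t := (convexified_normal_cone (ip_graph tr) (epi F) (x, t)).
Local Notation Nf x t := (convexified_normal_cone (ip_graph (@dotv R r)) (epi f) (lam x, t)).

Lemma convexified_lift x (s : E) J (t b : R^o) : joint_frames A x s J ->
  Nf x t (jdiag A s J, b) -> NF x t (s, b).
Proof.
move=> /joint_framesP[fJ xE sE] Ns.
pose phi (q : 'cV[R]_r * R^o) : E * R^o := (fsum J q.1, q.2).
have gE : inner_product (ip_graph tr) := ip_graph_inner_product trip_inner_product.
have gc := ip_graph_inner_product (dotv_inner_product R r).
have -> : (x, t) = phi (lam x, t) by rewrite /phi /= -xE.
have -> : (s, b) = phi (jdiag A s J, b) by rewrite /phi /= -sE.
apply: convexified_transfer Ns => //.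
- by move=> a u v; rewrite /phi /= fsumP.
- by move=> q; apply: fsum_norm.
- by move=> q w Cq reg; apply: regular_lift.
Qed.

Lemma convexified_perm g x (t : R^o) q : pcol g (lam x) = lam x ->
  Nf x t q -> Nf x t (pcol g q.1, q.2).
Proof.
move=> gx Nq; have gc := ip_graph_inner_product (dotv_inner_product R r).
pose phi (q : 'cV[R]_r * R^o) : 'cV[R]_r * R^o := (pcol g q.1, q.2).
have -> : (lam x, t) = phi (lam x, t) by rewrite /phi /= gx.
apply: (convexified_transfer gc (phi := phi)) Nq => //.
- by move=> a u v; rewrite /phi /= pcolP.
- by move=> o; rewrite /ipnorm /ip_graph /= dotv_pcol.
- move=> o w Co reg; split; last exact: regular_perm.
  by rewrite /epi /= symmetric_pcol.
Qed.

Lemma convexified_joint x (s : E) (t b : R^o) : NF x t (s, b) ->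
  exists2 J, joint_frames A x s J & Nf x t (jdiag A s J, b).
Proof.
have tip := trip_inner_product; have gE := ip_graph_inner_product tip.
have gc := ip_graph_inner_product (dotv_inner_product R r).
pose K (q : E * R^o) := exists2 J, joint_frames A x q.1 J & Nf x t (jdiag A q.1 J, q.2).
(* An element of [K] may be tested in any sorted frame of [x]; this yields both convexity and
   closedness of [K]. *)
have move_frame q J : K q -> jordan_frame A J -> x = fsum J (lam x) ->
    Nf x t (jdiag A q.1 J, q.2).
  move=> [J' jJ' Nq] fJ xE.
  apply: (convex_jdiag (K := fun v => Nf x t (v, q.2))) jJ' fJ xE Nq.
    apply/convex_setP => u v k Nu Nv k0 k1.
    have /convex_setP/(_ _ _ k Nu Nv k0 k1) := convexified_convex (C := epi f)
      (p := (lam x, t)) gc.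
    congr (convexified_normal_cone _ _ _ (_, _)).
    by rewrite /= -[X in _ = X]mul1r -[in RHS](subrKC k 1) mulrDl.
  by move=> g gx v Nv; have := convexified_perm gx Nv.
suff : NF x t `<=` K by move=> H /H.
apply: convexified_sub.
- apply/convex_setP => q1 q2 k K1 K2 k0 k1; have [J1 j1 _] := K1; have [J2 j2 _] := K2.
  have [J jJ] := opcomm_joint (opcommZD k (1 - k) (joint_opcomm j1) (joint_opcomm j2)).
  have [fJ xE _] := (joint_framesP _ _ _).1 jJ.
  exists J => //=; rewrite jdiagD.
  have /convex_setP/(_ _ _ k (move_frame _ _ K1 fJ xE) (move_frame _ _ K2 fJ xE) k0 k1) :=
    convexified_convex (C := epi f) (p := (lam x, t)) gc.
  exact.
- case=> s' b' Ks.
  have xs : opcomm A x s'.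
    apply: opcomm_limit => eps eps0; have [q [J jJ _] qs] := Ks _ eps0.
    exists x, q.1; split; first exact: joint_opcomm jJ.
      by rewrite subrr (ipnorm0 tip).
    exact: (ip_graph_close qs).
  have [J jJ] := opcomm_joint xs; have [fJ xE _] := (joint_framesP _ _ _).1 jJ.
  (* By [bessel], [jdiag] in the fixed frame [J] does not increase norms, so approximants in [K]
     give approximants of the coordinates. *)
  exists J => //=; apply: (ip_closureK gc) => eps /Ks[q Kq qs].
  exists (jdiag A q.1 J, q.2); first exact: move_frame.
  apply: le_lt_trans qs.
  rewrite -(ler_pXn2r (_ : 0 < 2)%N) ?nnegrE ?ipnorm_ge0 //.
  rewrite (sqr_ipnorm_graph (dotv_inner_product R r)) (sqr_ipnorm_graph tip) /= lerD2r.
  have -> : jdiag A q.1 J - jdiag A s' J = jdiag A (q.1 - s') J.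
    by apply/colP => i; rewrite !mxE tripDr // tripNr.
  rewrite -(sqr_ipnorm (dotv_inner_product R r)) -(sqr_ipnorm tip).
  by rewrite ler_pXn2r ?nnegrE ?ipnorm_ge0 //; apply: bessel.
- case=> s' b' /normal_cone_joint[J jJ NJ]; exists J => //.
  by apply: sub_ip_closure => //; apply: sub_conv_hull.
Qed.

Lemma clarke_spectral x : clarke tr F x =
  [set s : E | exists2 J, joint_frames A x s J & clarke (@dotv R r) f (lam x) (jdiag A s J)].
Proof.
apply/seteqP; split=> s.
  move=> [Ffin /convexified_joint[J jJ Ns]]; by exists J.
move=> [J jJ [ffin Ns]]; split=> //; exact: convexified_lift jJ Ns.
Qed.

End Transfer.

Theorem theorem19 (R : realType) (E : vectType R)
  (A : euclidean_jordan_algebra E) (r : nat) (hr : has_rank A r)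
  (f : 'cV[R]_r -> \bar R) (hf : symmetric_fun f) (x : E) :
  (forall (DR : subdiff R 'cV[R]_r) (DE : subdiff R E),
     permutation_compatible DR ->
     DE (spectral_fun A f) x =
       [set s : E | exists2 J : 'I_r -> E, joint_frames A x s J &
                  DR f (eigvals A r x) (jdiag A s J)] ->
     conv_hull (DE (spectral_fun A f) x) =
       [set s : E | exists2 J : 'I_r -> E, joint_frames A x s J &
                  conv_hull (DR f (eigvals A r x)) (jdiag A s J)])
  /\
  (interior (edom f) (eigvals A r x) ->
   locally_lipschitz_at f (eigvals A r x) ->
   clarke (trip A r) (spectral_fun A f) x =
     [set s : E | exists2 J : 'I_r -> E, joint_frames A x s J &
                clarke (@dotv R r) f (eigvals A r x) (jdiag A s J)]).
Proof.
split; last by move=> _ _; apply: clarke_spectral.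
move=> DR DE DRperm ->; apply: joint_conv_hull => // g gx v Dv.
(* Permutation compatibility, applied to a permutation that fixes [eigvals A r x], makes the set
   invariant under it. *)
rewrite -gx pcolE DRperm ?is_perm_perm_mx //; exists v => //.
by rewrite -pcolE.
Qed.
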